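(* The (geometric realization of the) simplicial complex $D_{5,2}$ is homotopy equivalent to a wedge of four spheres of dimension $5$.
   Context: $\mathcal{G}_5$ is the set of simple undirected graphs on the vertex set $\{1,2,3,4,5\}$; each graph is identified with its edge set. A set $D\subseteq\{1,\ldots,5\}$ dominates $\sigma\in\mathcal{G}_5$ if every vertex not in $D$ is adjacent in $\sigma$ to some vertex of $D$. The domination number $\gamma(\sigma)$ is the minimal cardinality of a dominating set of $\sigma$. $D_{5,2}$ is the abstract simplicial complex whose $d$-dimensional simplices ($d\ge0$) are the graphs $\sigma\in\mathcal{G}_5$ (viewed as edge sets) having exactly $d+1$ edges and satisfying $\gamma(\sigma)\ge 2$. *)

(* Defs.v *)
From HB Require Import structures.
From mathcomp Require Import all_boot all_order all_algebra.
From mathcomp Require Import all_classical all_reals all_analysis.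
From mathcomp Require Import homotopy.

Set Implicit Arguments.
Unset Strict Implicit.
Unset Printing Implicit Defensive.

Import Order.TTheory GRing.Theory Num.Theory.
Import numFieldNormedType.Exports.

Local Open Scope classical_set_scope.
Local Open Scope ring_scope.

Section Graphs.
Variable n : nat.

Definition edge := {e : {set 'I_n} | #|e| == 2%N}.

(* A simple graph on the vertex set 'I_n is identified with its edge set. *)
Definition graph := {set edge}.

Definition adjacent (s : graph) (u v : 'I_n) : bool :=
  [exists e in s, val e == [set u; v]%SET].

Definition dominates (A : {set 'I_n}) (s : graph) : bool :=
  [forall v, (v \notin A) ==> [exists u in A, adjacent s v u]].

(* The whole vertex set, used as default of the minimization, dominates
   every graph. *)
Definition domination_number (s : graph) : nat :=
  #|[arg min_(A < [set: 'I_n]%SET | dominates A s) #|A|]|.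

Lemma dominatesT (s : graph) : dominates [set: 'I_n]%SET s.
Proof. by apply/forallP => v; rewrite inE. Qed.

Lemma dominatesS (A : {set 'I_n}) (s t : graph) :
  t \subset s -> dominates A t -> dominates A s.
Proof.
move=> /fintype.subsetP ts /forallP At; apply/forallP => v; apply/implyP => vA.
have /existsP[u /andP[uA /existsP[e /andP[et uv]]]] := implyP (At v) vA.
by apply/existsP; exists u; rewrite uA; apply/existsP; exists e; rewrite ts.
Qed.

Lemma domination_numberS (s t : graph) :
  t \subset s -> (domination_number s <= domination_number t)%N.
Proof.
move=> ts; rewrite /domination_number.
case: arg_minnP => [|A _ minA]; first exact: dominatesT.
case: arg_minnP => [|B tB _]; first exact: dominatesT.
exact/minA/(dominatesS ts).
Qed.

End Graphs.

(* Finite abstract simplicial complexes with vertices in V; only nonempty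
   simplices are listed, and elements of V need not be vertices. *)
Record simplicial_complex (V : finType) := SimplicialComplex {
  simplices : {set {set V}};
  simplices_neq0 : forall s : {set V}, s \in simplices -> s != finset.set0;
  simplicesS : forall s t : {set V}, s \in simplices ->
    t \subset s -> t != finset.set0 -> t \in simplices }.

Section DominationComplex.
Variables n k : nat.

(* A simplex of dimension d >= 0 is a graph with d + 1 edges, so the simplices
   are nonempty graphs. *)
Definition domination_simplices : {set graph n} :=
  [set s : graph n | (s != finset.set0) && (k <= domination_number s)%N]%SET.

Lemma domination_simplices_neq0 (s : graph n) :
  s \in domination_simplices -> s != finset.set0.
Proof. by rewrite inE => /andP[]. Qed.

Lemma domination_simplicesS (s t : graph n) : s \in domination_simplices ->
  t \subset s -> t != finset.set0 -> t \in domination_simplices.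
Proof.
rewrite !inE => /andP[_ ks] ts ->.
exact: leq_trans ks (domination_numberS ts).
Qed.

Definition domination_complex : simplicial_complex (edge n) :=
  SimplicialComplex domination_simplices_neq0 domination_simplicesS.

End DominationComplex.

(* Barycentric coordinates, with the subspace topology of the finite product
   R^V. *)
Definition realization (R : realType) (V : finType)
    (K : simplicial_complex V) : set {ptws V -> R} :=
  [set x | [/\ forall v, 0 <= x v, \sum_v x v = 1 &
               [set v | x v != 0]%SET \in simplices K]].
Arguments realization R {V} K _.

Definition geometric_realization (R : realType) (V : finType)
    (K : simplicial_complex V) : topologicalType :=
  set_type (realization R K).

(* The unit Euclidean sphere; the library norm on row vectors is the sup norm,
   hence the explicit sum of squares. *)
Definition sphere (R : realType) (n : nat) : set 'rV[R]_n.+1 :=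
  [set x | \sum_i x ord0 i ^+ 2 = 1].
Arguments sphere : clear implicits.

Lemma delta_mx_sphere (R : realType) (n : nat) :
  (delta_mx ord0 ord0 : 'rV[R]_n.+1) \in sphere R n.
Proof.
rewrite inE /sphere /= (bigD1 ord0) //= !mxE !eqxx expr1n big1 ?addr0 // => i.
by move=> /negPf i0; rewrite mxE i0 andbF expr0n.
Qed.

Definition sphere_point (R : realType) (n : nat) : set_type (sphere R n) :=
  exist (fun x => x \in sphere R n) _ (delta_mx_sphere R n).

Definition wedge_of_spheres (R : realType) (m n : nat) : topologicalType :=
  wedge (fun _ : 'I_m => sphere_point R n).

Section Homotopy.
Variable R : realType.

(* A map on X * [0, 1] is given by its values there, as a map on X * R that is
   continuous within X * [0, 1]. *)
Definition homotopic (X Y : topologicalType) (f g : X -> Y) : Prop :=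
  exists H : X * R -> Y,
    [/\ {within [set: X] `*` [set` `[0, 1]], continuous H},
        forall x, H (x, 0) = f x & forall x, H (x, 1) = g x].

Definition homotopy_equivalent (X Y : topologicalType) : Prop :=
  exists (f : X -> Y) (g : Y -> X),
    [/\ continuous f, continuous g,
        homotopic (g \o f) id & homotopic (f \o g) id].

End Homotopy.

(* Main.v *)
From HB Require Import structures.
Require Import Defs.
From mathcomp Require Import all_boot all_order all_algebra.
From mathcomp Require Import all_classical all_reals all_analysis.
From mathcomp Require Import homotopy.
From mathcomp Require Import zify ring lra.

Set Implicit Arguments.
Unset Strict Implicit.
Unset Printing Implicit Defensive.

Import Order.TTheory GRing.Theory Num.Theory.
Import numFieldNormedType.Exports.

Local Open Scope classical_set_scope.
Local Open Scope ring_scope.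

(* A graph on five vertices has domination number at least 2 iff it contains
   none of the five stars, each consisting of the four edges at a vertex. The
   four copies of K4 avoiding the vertices 0, 1, 2, 3 have six edges and are
   facets of D_{5,2}. The subcomplex L obtained by deleting these four open
   5-simplices is collapsible, so D_{5,2} is homotopy equivalent to its
   quotient by L, a wedge of four 5-spheres.

   The maps are explicit. A collapse that removes the faces containing t, the
   link of t being a cone with apex e, is the flow moving the mass
   min_{v in t} x_v from each vertex of t to e. The map to the wedge sends a
   facet onto its sphere and L to the base point. Its homotopy inverse maps a
   neighborhood of -base radially onto a facet, and then follows the flow
   contracting L on the remaining collar. *)

(** * Continuity *)

(** A graph contains no star at a vertex iff its complement is an edge cover of K5. The facets of
    D_{5,2} are thus the complements of the minimal edge covers: the five copies of K4, whose
    complements are stars, and thirty graphs with seven edges, whose complements are a path on three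
    vertices and a disjoint edge. So the complex has dimension 6 and five 5-dimensional facets, of
    which only four survive as spheres. The fifth K4, on the vertices 0, 1, 2, 3, disappears during
    the collapse.

    That a contractible subcomplex can be shrunk to a point usually rests on homotopy extension;
    explicit homotopies replace it here. Two obstacles shape them. The flow stays in the complex
    only off the open cells, so the homotopy on the realization first pushes points to the boundary
    of their cell and only then follows the flow. On the wedge, the composite is not the identity,
    but it sends no point to its antipode, so normalized segments join it to the identity and fix
    the base point. *)

Section Continuity.
Variable T : topologicalType.

Lemma ptws_cvg_coord (R : topologicalType) (V : Type) (f : T -> {ptws V -> R}) t :
  (forall v, f s v @[s --> t] --> f t v) -> f s @[s --> t] --> f t.
Proof.
move=> cf; apply/cvg_sup => v U [W [[B oB <-]] /= Bt] /filterS; apply.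
exact: cf (open_nbhs_nbhs (conj oB Bt)).
Qed.

Lemma set_type_cvg (X : topologicalType) (A : set X) (f : T -> set_type A) t :
  set_val (f s) @[s --> t] --> set_val (f t) -> f s @[s --> t] --> f t.
Proof.
move=> cf U [W [[B oB <-]] /= Bt] /filterS; apply.
exact: cf (open_nbhs_nbhs (conj oB Bt)).
Qed.

Lemma mx_cvg_coord (R : topologicalType) m n (f : T -> 'M[R]_(m, n)) t :
  (forall i j, f s i j @[s --> t] --> f t i j) -> f s @[s --> t] --> f t.
Proof.
move=> cf U [P tP] /filterS; apply.
have: \forall s \near t, forall k : 'I_m * 'I_n, P k.1 k.2 (f s k.1 k.2).
  by apply: filter_forall => -[k l]; exact: cf (tP k l).
by apply: filterS => s Ps i j; exact: (Ps (i, j)).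
Qed.

Lemma near_forall (I : finType) (P : I -> T -> Prop) (t : T) :
  (forall i, \forall s \near t, P i s) -> \forall s \near t, forall i, P i s.
Proof. by move=> nP; apply: filter_forall. Qed.

Lemma near_cvg (U : topologicalType) (f g : T -> U) t :
  (\forall s \near t, f s = g s) ->
  g s @[s --> t] --> g t -> f s @[s --> t] --> f t.
Proof.
move=> fg cg; rewrite (nbhs_singleton fg) => A /cg; rewrite !nbhs_simpl /=.
by apply: filterS2 fg => s /= ->.
Qed.

Variable R : realType.
Implicit Types (f g : T -> R) (t : T).

(* The wrappers below keep the source space abstract: on the concrete types
   [set_type _] the neighborhood filters get unfolded by unification. *)
Lemma cst_cvg (c : R) t : (fun=> c) s @[s --> t] --> c.
Proof. exact: cvg_cst. Qed.

Lemma mul_cvg f g t : f s @[s --> t] --> f t -> g s @[s --> t] --> g t ->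
  f s * g s @[s --> t] --> f t * g t.
Proof. exact: cvgM. Qed.

Lemma add_cvg f g t : f s @[s --> t] --> f t -> g s @[s --> t] --> g t ->
  f s + g s @[s --> t] --> f t + g t.
Proof. exact: cvgD. Qed.

Lemma near_lt f t a : f s @[s --> t] --> f t -> f t < a ->
  \forall s \near t, f s < a.
Proof. by move=> cf; exact: cvgr_lt. Qed.

Lemma near_gt f t a : f s @[s --> t] --> f t -> a < f t ->
  \forall s \near t, a < f s.
Proof. by move=> cf; exact: cvgr_gt. Qed.

Lemma min_cvg f g t : f s @[s --> t] --> f t -> g s @[s --> t] --> g t ->
  Num.min (f s) (g s) @[s --> t] --> Num.min (f t) (g t).
Proof. by move=> cf cg; exact: (@continuous_min _ _ f g). Qed.

Lemma max_cvg f g t : f s @[s --> t] --> f t -> g s @[s --> t] --> g t ->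
  Num.max (f s) (g s) @[s --> t] --> Num.max (f t) (g t).
Proof. by move=> cf cg; exact: (@continuous_max _ _ f g). Qed.

Lemma bigmin_cvg (I : Type) (r : seq I) (P : pred I) (x0 : R) (F : I -> T -> R)
  t : (forall i, P i -> F i s @[s --> t] --> F i t) ->
  \big[Num.min/x0]_(i <- r | P i) F i s @[s --> t]
    --> \big[Num.min/x0]_(i <- r | P i) F i t.
Proof.
move=> cF; elim: r => [|i r IHr].
  by under eq_cvg do rewrite big_nil; rewrite big_nil; exact: cvg_cst.
under eq_cvg do rewrite big_cons; rewrite big_cons.
by case: ifP => // Pi; apply: min_cvg => //; exact: cF.
Qed.

Lemma sum_cvg (I : Type) (r : seq I) (P : pred I) (F : I -> T -> R) t :
  (forall i, P i -> F i s @[s --> t] --> F i t) ->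
  \sum_(i <- r | P i) F i s @[s --> t] --> \sum_(i <- r | P i) F i t.
Proof.
move=> cF; elim: r => [|i r IHr].
  by under eq_cvg do rewrite big_nil; rewrite big_nil; exact: cvg_cst.
under eq_cvg do rewrite big_cons; rewrite big_cons.
by case: ifP => // Pi; apply: cvgD => //; exact: cF.
Qed.

End Continuity.

(** * Collapses *)

Section Avoidance.
Variable V : finType.
Implicit Types (F : seq {set V}) (s t : {set V}) (a : {set V} * V).

(** A complex is encoded by forbidden sets rather than by its faces, so that removing all faces
    containing [t] amounts to consing [t]. *)
Definition avoids F s := all (fun t => ~~ (t \subset s)) F.

Lemma avoidsS F s t : t \subset s -> avoids F s -> avoids F t.
Proof.
move=> ts; apply: sub_all => r; apply: contra => rt; exact: fintype.subset_trans ts.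
Qed.

(* Every face containing [a.1] can be enlarged by the vertex [a.2], i.e. the
   link of [a.1] is a cone with apex [a.2]. *)
Definition free_face F a : Prop :=
  [/\ a.1 != finset.set0, a.2 \notin a.1 &
      forall s, avoids F s -> a.1 \subset s -> avoids F (a.2 |: s)].

Fixpoint collapses F (c : seq ({set V} * V)) (v0 : V) : Prop :=
  if c is a :: c' then free_face F a /\ collapses (a.1 :: F) c' v0
  else forall s, avoids F s -> s \subset [set v0]%SET.

End Avoidance.

Section Clamp.
Variable R : realType.
Implicit Type t : R.

(** Clamped times make every homotopy constant outside the unit interval, hence defined and
    continuous for all real times and easy to shift and concatenate. *)
Definition clamp t : R := Num.max 0 (Num.min 1 t).

Lemma clamp_ge0 t : 0 <= clamp t.
Proof. by rewrite /clamp le_max lexx. Qed.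

Lemma clamp_le1 t : clamp t <= 1.
Proof. by rewrite /clamp ge_max ler01 ge_min lexx. Qed.

Lemma clamp_le0 t : t <= 0 -> clamp t = 0.
Proof. by move=> t0; apply/max_idPl; rewrite ge_min t0 orbT. Qed.

Lemma clamp_ge1 t : 1 <= t -> clamp t = 1.
Proof. by move=> t1; rewrite /clamp (min_idPl t1); apply/max_idPr. Qed.

Lemma clamp_cvg (T : topologicalType) (f : T -> R) x :
  f y @[y --> x] --> f x -> clamp (f y) @[y --> x] --> clamp (f x).
Proof.
by move=> cf; apply: max_cvg; [exact: cvg_cst|apply: min_cvg => //; exact: cvg_cst].
Qed.

End Clamp.

Section Flow.
Variables (R : realType) (V : finType).
Implicit Types (x : V -> R) (s : {set V}) (a : {set V} * V) (t : R).

Definition barycentric x := (forall v, 0 <= x v) /\ \sum_v x v = 1.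

Definition supp x : {set V} := [set v | x v != 0]%SET.

Lemma barycentric_le1 x v : barycentric x -> x v <= 1.
Proof.
by move=> [x0 <-]; rewrite (bigD1 v)//= lerDl sumr_ge0.
Qed.

Lemma barycentric_supp_neq0 x : barycentric x -> supp x != finset.set0.
Proof.
move=> [_ x1]; apply/eqP => s0; move/eqP: x1; rewrite big1 => [|v _].
  by rewrite eq_sym oner_eq0.
by apply/eqP; have := finset.in_set0 v; rewrite -s0 inE => /negbFE.
Qed.

Lemma barycentric_supp1 x v0 : barycentric x -> supp x \subset [set v0]%SET ->
  x = fun v => (v == v0)%:R.
Proof.
move=> [x0 x1] sx; have xv v : v != v0 -> x v = 0.
  move=> vv0; have := fintype.subsetP sx v; rewrite !inE (negPf vv0).
  by case: eqVneq => // _ /(_ isT).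
apply/funext => v; have [->|/xv//] := eqVneq v v0.
by rewrite -x1 (bigD1 v0)//= big1 ?addr0 // => w /xv.
Qed.

(** The default 1 bounds all barycentric coordinates, so for nonempty [s] it does not affect the
    minimum. *)
Definition depth s x : R := \big[Num.min/1]_(v in s) x v.

Lemma depth_ge0 s x : (forall v, 0 <= x v) -> 0 <= depth s x.
Proof. by move=> x0; apply/bigmin_geP; split=> [|v _]; rewrite ?ler01. Qed.

Lemma depth_le s x v : v \in s -> depth s x <= x v.
Proof. by move=> vs; apply: bigmin_le_cond. Qed.

Lemma depth_gt0 s x : (forall v, 0 <= x v) -> (0 < depth s x) = (s \subset supp x).
Proof.
move=> x0; apply/bigmin_gtP/fintype.subsetP => [[_ xs] v vs|sx].
  by rewrite inE gt_eqF // xs.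
by split=> [|v vs]; rewrite ?ltr01 // lt_def x0 andbT; have := sx v vs; rewrite inE.
Qed.

Lemma depth_eq0 s x : (forall v, 0 <= x v) -> (depth s x == 0) = ~~ (s \subset supp x).
Proof. by move=> x0; rewrite -depth_gt0 // lt_def depth_ge0 // andbT negbK. Qed.

Lemma depth_attained s x : (forall v, x v <= 1) -> s != finset.set0 ->
  exists2 v, v \in s & depth s x = x v.
Proof.
move=> x1 /finset.set0Pn[w ws].
by have [v] := @eq_bigmin _ _ _ 1 w (mem s) x ws (fun v _ => x1 v); exists v.
Qed.

Lemma depth_cvg (T : topologicalType) s (X : T -> V -> R) y :
  (forall v, X z v @[z --> y] --> X y v) ->
  depth s (X z) @[z --> y] --> depth s (X y).
Proof. by move=> cX; apply: bigmin_cvg => v _; exact: cX. Qed.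

(** The factor [depth a.1 x] vanishes unless the support contains [a.1]. Points of the smaller
    complex are therefore fixed, and continuity needs no case distinction. *)
Definition push a x t : V -> R := fun v =>
  x v + clamp t * depth a.1 x * ((v == a.2)%:R * #|a.1|%:R - (v \in a.1)%:R).

Lemma push_le0 a x t : t <= 0 -> push a x t = x.
Proof. by move=> t0; apply/funext => v; rewrite /push clamp_le0 // !mul0r addr0. Qed.

Lemma push_fixed a x t : depth a.1 x = 0 -> push a x t = x.
Proof. by move=> d0; apply/funext => v; rewrite /push d0 mulr0 mul0r addr0. Qed.

Lemma push_barycentric a x t : a.2 \notin a.1 -> barycentric x ->
  barycentric (push a x t).
Proof.
move=> aN [x0 x1]; split=> [v|].
  rewrite /push; have d0 := depth_ge0 a.1 x0.
  have [va|va] := boolP (v \in a.1); last first.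
    by rewrite subr0 addr_ge0 // !mulr_ge0 ?clamp_ge0 ?ler0n.
  have -> : (v == a.2) = false by apply: contraNF aN => /eqP <-.
  rewrite mul0r sub0r mulrN1 subr_ge0 (le_trans _ (depth_le x va)) //.
  by rewrite ler_piMl ?clamp_le1.
rewrite big_split /= x1 -mulr_sumr sumrB.
rewrite (bigD1 a.2) //= eqxx mul1r big1 ?addr0; last by move=> i /negPf->; rewrite mul0r.
rewrite -sum1_card natr_sum [X in X - _]big_mkcond /= -sumrB big1 ?mulr0 ?addr0 //.
by move=> v _; case: (v \in a.1); rewrite subrr.
Qed.

Lemma push_supp a x t : supp (push a x t) \subset a.2 |: (supp x :|: a.1).
Proof.
apply/fintype.subsetP => v; rewrite !inE; apply: contraNT.
rewrite !negb_or negbK => /and3P[/negPf va2 /eqP xv /negPf va1].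
by rewrite /push xv va2 va1 mul0r subr0 mulr0 addr0.
Qed.

Lemma push_avoids F a x t : free_face F a -> barycentric x ->
  avoids F (supp x) -> avoids F (supp (push a x t)).
Proof.
move=> [a0 aN aF] [x0 x1] Fx; have [sx|sx] := boolP (a.1 \subset supp x).
  apply: avoidsS (aF _ Fx sx); apply: fintype.subset_trans (push_supp _ _ _) _.
  by rewrite (finset.setUidPl sx).
by rewrite push_fixed //; apply/eqP; rewrite depth_eq0.
Qed.

Lemma push_end F a x t : free_face F a -> barycentric x ->
  avoids F (supp x) -> 1 <= t -> avoids (a.1 :: F) (supp (push a x t)).
Proof.
move=> aF bx Fx t1; rewrite /= push_avoids // andbT.
case: aF => a0 aN aF; have [x0 x1] := bx.
have [sx|sx] := boolP (a.1 \subset supp x); last first.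
  by rewrite push_fixed //; apply/eqP; rewrite depth_eq0.
(* A vertex of [a.1] with the least coordinate loses all its mass, and the apex that gains mass is
   not in [a.1]; hence [a.1] leaves the support. *)
have [v va dv] := depth_attained (fun v => barycentric_le1 v bx) a0.
apply/fintype.subsetPn; exists v => //; rewrite inE negbK /push clamp_ge1 // dv va.
have -> : (v == a.2) = false by apply: contraNF aN => /eqP <-.
by rewrite mul0r sub0r mul1r mulrN1 subrr.
Qed.

Lemma push_cvg (T : topologicalType) a (X : T -> V -> R) (f : T -> R) y :
  (forall v, X z v @[z --> y] --> X y v) -> f z @[z --> y] --> f y ->
  forall v, push a (X z) (f z) v @[z --> y] --> push a (X y) (f y) v.
Proof.
move=> cX cf v; apply: cvgD; first exact: cX.
apply: cvgM; last exact: cvg_cst.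
by apply: cvgM; [exact: clamp_cvg|exact: depth_cvg].
Qed.

(** Each collapse takes one unit of time; because [push] clamps its time, a later collapse waits
    until the earlier ones are complete. *)
Fixpoint flow (c : seq ({set V} * V)) x t : V -> R :=
  if c is a :: c' then flow c' (push a x t) (t - 1) else x.

Lemma flow_le0 c x t : t <= 0 -> flow c x t = x.
Proof.
elim: c x t => //= a c IHc x t t0.
by rewrite push_le0 // IHc // (le_trans _ t0) // gerBl.
Qed.

Lemma flow_cvg (T : topologicalType) c (X : T -> V -> R) (f : T -> R) y :
  (forall v, X z v @[z --> y] --> X y v) -> f z @[z --> y] --> f y ->
  forall v, flow c (X z) (f z) v @[z --> y] --> flow c (X y) (f y) v.
Proof.
elim: c X f => //= a c IHc X f cX cf v.
apply: (IHc (fun z => push a (X z) (f z)) (fun z => f z - 1)).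
  exact: push_cvg.
by apply: cvgB => //; exact: cvg_cst.
Qed.

Lemma flow_avoids F c v0 x t : collapses F c v0 -> barycentric x ->
  avoids F (supp x) -> barycentric (flow c x t) /\ avoids F (supp (flow c x t)).
Proof.
elim: c F x t => //= a c IHc F x t [aF cF] bx Fx.
have [a0 aN _] := aF.
(* Up to time 1 only the first push acts; afterwards it is complete, and the induction hypothesis
   applies in the smaller complex. *)
have [t1|t1] := leP t 1.
  rewrite flow_le0 ?subr_le0 //; split; first exact: push_barycentric.
  exact: push_avoids.
have [? /andP[_ ?]] := IHc _ _ (t - 1) cF (push_barycentric t aN bx)
  (push_end aF bx Fx (ltW t1)).
by [].
Qed.

Lemma flow_end F c v0 x t : collapses F c v0 -> barycentric x ->
  avoids F (supp x) -> (size c)%:R <= t -> flow c x t = fun v => (v == v0)%:R.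
Proof.
elim: c F x t => [|a c IHc] F x t /= => [cF bx Fx _|[aF cF] bx Fx ct].
  exact: barycentric_supp1 (cF _ Fx).
have [a0 aN _] := aF; apply: IHc cF _ _ _.
- exact: push_barycentric.
- by apply: push_end; rewrite // (le_trans _ ct) // ler1n.
- by rewrite lerBrDr natr1.
Qed.

End Flow.

(** * Spheres *)

Section Sphere.
Variables (R : realType) (n : nat).
Implicit Type z : 'rV[R]_n.+1.

Definition sqnorm z : R := \sum_i z ord0 i ^+ 2.

Lemma sqnorm_ge0 z : 0 <= sqnorm z.
Proof. by apply: sumr_ge0 => i _; rewrite sqr_ge0. Qed.

Lemma sqnorm_eq0 z : (sqnorm z == 0) = (z == 0).
Proof.
rewrite psumr_eq0 => [|i _]; last exact: sqr_ge0.
apply/allP/eqP => [z0|-> i _]; last by rewrite mxE expr0n eqxx.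
apply/rowP => i; rewrite mxE; apply/eqP; rewrite -sqrf_eq0.
exact: (z0 i (mem_index_enum i)).
Qed.

Lemma sqnormZ a z : sqnorm (a *: z) = a ^+ 2 * sqnorm z.
Proof. by rewrite /sqnorm mulr_sumr; apply: eq_bigr => i _; rewrite mxE exprMn. Qed.

Definition normalize z : 'rV[R]_n.+1 := (Num.sqrt (sqnorm z))^-1 *: z.

Lemma sqrt_sqnorm_gt0 z : z != 0 -> 0 < Num.sqrt (sqnorm z).
Proof. by move=> z0; rewrite sqrtr_gt0 lt_def sqnorm_ge0 sqnorm_eq0 z0. Qed.

Lemma normalize_sphere z : z != 0 -> sphere R n (normalize z).
Proof.
move=> z0; rewrite /sphere /= -/(sqnorm _) sqnormZ exprVn sqr_sqrtr ?sqnorm_ge0 //.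
by rewrite mulVf // sqnorm_eq0.
Qed.

Lemma normalize_id z : sphere R n z -> normalize z = z.
Proof. by rewrite /normalize /sqnorm /sphere /= => ->; rewrite sqrtr1 invr1 scale1r. Qed.

Lemma normalize_cvg (T : topologicalType) (f : T -> 'rV[R]_n.+1) y :
  f y != 0 -> f s @[s --> y] --> f y ->
  normalize (f s) @[s --> y] --> normalize (f y).
Proof.
move=> fy0 cf; have cfi i : f s ord0 i @[s --> y] --> f y ord0 i.
  by apply: (@continuous_comp _ _ _ f (fun M : 'rV[R]_n.+1 => M ord0 i)) => //;
    exact: coord_continuous.
apply: mx_cvg_coord => i j; rewrite ord1 mxE; under eq_cvg do rewrite mxE.
apply: cvgM => //; apply: cvgV; first by rewrite gt_eqF ?sqrt_sqnorm_gt0.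
apply: (@continuous_comp _ _ _ (fun s => sqnorm (f s)) (@Num.sqrt R)); last first.
  exact: sqrt_continuous.
by apply: sum_cvg => k _; apply: cvgM.
Qed.

(* The segment between two points of the sphere avoids the origin unless they
   are antipodal. *)
Lemma segment_neq0 z z' t : sphere R n z -> sphere R n z' -> z' != - z ->
  0 <= t <= 1 -> (1 - t) *: z' + t *: z != 0.
Proof.
move=> z1 z'1 zz' /andP[t0 t1]; apply: contra_neq zz' => /eqP.
rewrite addr_eq0 => /eqP zz'.
have: sqnorm ((1 - t) *: z') = sqnorm (- (t *: z)) by rewrite zz'.
rewrite -scaleNr !sqnormZ /sqnorm z1 z'1 !mulr1 => tt.
have t2 : t = 2^-1 by move: tt; rewrite sqrrN; lra.
move: zz'; rewrite t2 -scalerN (_ : 1 - 2^-1 = 2^-1); last by lra.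
by apply: scalerI; rewrite invr_eq0 pnatr_eq0.
Qed.

Definition to_sphere z : set_type (sphere R n) := insubd (sphere_point R n) z.

Lemma to_sphereK z : sphere R n z -> set_val (to_sphere z) = z.
Proof. by move=> z1; rewrite set_valE /to_sphere insubdK //; exact/mem_set. Qed.

Lemma to_sphere_cvg (T : topologicalType) (f : T -> 'rV[R]_n.+1) y :
  (forall s, sphere R n (f s)) -> f s @[s --> y] --> f y ->
  to_sphere (f s) @[s --> y] --> to_sphere (f y).
Proof.
move=> Sf cf; apply: set_type_cvg; rewrite to_sphereK //.
rewrite (_ : (fun s => _) = f) //; apply/funext => s; exact: to_sphereK.
Qed.

Lemma to_sphere_val (u : set_type (sphere R n)) : to_sphere (set_val u) = u.
Proof. by rewrite /to_sphere set_valE valKd. Qed.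

Lemma sphere_val (u : set_type (sphere R n)) : sphere R n (set_val u).
Proof. exact: set_valP. Qed.

Lemma sphere_point_coord : set_val (sphere_point R n) ord0 ord0 = 1.
Proof. by rewrite set_valE /= mxE eqxx. Qed.

Lemma sphere_coord_continuous i :
  continuous (fun u : set_type (sphere R n) => (set_val u : 'rV[R]_n.+1) ord0 i).
Proof.
move=> u.
apply: (@continuous_comp _ _ _ (set_val : set_type (sphere R n) -> _)
  (fun M : 'rV[R]_n.+1 => M ord0 i)); first exact: initial_continuous.
exact: coord_continuous.
Qed.

(** The base point is the only point of the sphere with first coordinate 1. Closedness is what
    gluing homotopies on the wedge requires. *)
Lemma closed_sphere_point : closed [set sphere_point R n].
Proof.
have -> : [set sphere_point R n] =
    (fun u : set_type (sphere R n) => (set_val u : 'rV[R]_n.+1) ord0 ord0) @^-1`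
    [set 1].
  apply/seteqP; split=> [_ ->|u /= u0]; first exact: sphere_point_coord.
  apply: val_inj => /=; apply/rowP => i; have := sphere_val u.
  rewrite -set_valE /sphere /= (bigD1 ord0) //= u0 expr1n -[RHS]addr0 => /addrI.
  rewrite mxE eqxx /=; have [->|i0 s0] := eqVneq i ord0; first by rewrite u0.
  by apply/eqP; rewrite -sqrf_eq0 (psumr_eq0P _ s0) // => *; exact: sqr_ge0.
apply: closed_comp; last exact: closed_eq.
by move=> u _; exact: sphere_coord_continuous.
Qed.

End Sphere.

(** * Cells attached to a contractible complex *)

Section CellAttachment.
Variables (R : realType) (V : finType) (K : simplicial_complex V) (m n : nat).
Variable phi : 'I_m.+1 -> 'I_n.+1 -> V.

Implicit Types (x : V -> R) (i : 'I_m.+1).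

Definition cell i : {set V} := [set phi i j | j : 'I_n.+1]%SET.

Hypothesis phi_inj : forall i, injective (phi i).
Hypothesis cell_simplex : forall i, cell i \in simplices K.
Hypothesis cell_facet :
  forall i s, s \in simplices K -> cell i \subset s -> s = cell i.
Hypothesis cell_inj : injective cell.

Definition off_cells (x : V -> R) :=
  realization R K x /\ forall i, ~~ (cell i \subset supp x).

Variables (h : (V -> R) -> R -> V -> R) (pt : V -> R).
Hypothesis h_le0 : forall x (t : R), t <= 0 -> h x t = x.
Hypothesis h_off : forall x t, off_cells x -> off_cells (h x t).
Hypothesis h_end : forall x t, off_cells x -> 1 <= t -> h x t = pt.
Hypothesis pt_off : off_cells pt.
(** Continuity is asked at all coordinate functions, not only off the cells, so that formulas which
    apply [h] at time at most 0 inside open cells remain continuous. *)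
Hypothesis h_cvg : forall (T : topologicalType) (X : T -> V -> R) (f : T -> R) y,
  (forall v, X z v @[z --> y] --> X y v) -> f z @[z --> y] --> f y ->
  forall v, h (X z) (f z) v @[z --> y] --> h (X y) (f y) v.

Local Notation X := (geometric_realization R K).
Local Notation S := (set_type (sphere R n)).
Local Notation base := (sphere_point R n).
Local Notation W := (wedge (fun _ : 'I_m.+1 => base)).
Local Notation N := (n.+1%:R : R).
Local Notation coord z j := ((z : 'rV[R]_n.+1) ord0 j).

Let N_gt0 : 0 < N. Proof. by rewrite ltr0n. Qed.
Let N_neq0 : N != 0. Proof. by rewrite gt_eqF. Qed.

Lemma realization_barycentric x : realization R K x -> barycentric x.
Proof. by case. Qed.

Lemma realization_supp x : realization R K x -> supp x \in simplices K.
Proof. by case. Qed.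

Lemma realizationS x s : barycentric x -> s \in simplices K ->
  supp x \subset s -> realization R K x.
Proof.
move=> bx sK xs; have [x0 x1] := bx; split=> //; apply: simplicesS sK xs _.
exact: barycentric_supp_neq0.
Qed.

Lemma supp_cell i x : realization R K x -> cell i \subset supp x -> supp x = cell i.
Proof. by move=> /realization_supp; exact: cell_facet. Qed.

Lemma cell_uniq i k x : realization R K x ->
  cell i \subset supp x -> cell k \subset supp x -> i = k.
Proof.
by move=> Kx /(supp_cell Kx) ci /(supp_cell Kx) ck; apply: cell_inj; rewrite -ci.
Qed.

Lemma cell_other i k (s : {set V}) : k != i -> s \subset cell i -> ~~ (cell k \subset s).
Proof.
move=> ki si; apply: contra ki => ks; apply/eqP/esym/cell_inj.
exact: cell_facet (cell_simplex i) (fintype.subset_trans ks si).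
Qed.

Lemma mem_cell i j : phi i j \in cell i.
Proof. exact: imset_f. Qed.

Lemma cell_neq0 i : cell i != finset.set0.
Proof. by apply/finset.set0Pn; exists (phi i ord0); exact: mem_cell. Qed.

Lemma card_cell i : #|cell i| = n.+1.
Proof. by rewrite card_imset // card_ord. Qed.

Lemma sum_cell i x : barycentric x -> supp x \subset cell i ->
  \sum_j x (phi i j) = 1.
Proof.
move=> [_ <-] xi; rewrite [RHS](bigID (mem (cell i))) /= [X in _ + X]big1 ?addr0.
  rewrite big_imset /=; last by move=> ? ? _ _; exact: phi_inj.
  by apply: eq_bigl => j; rewrite inE.
by move=> v; apply: contraNeq => xv; apply: (fintype.subsetP xi); rewrite inE.
Qed.

(** * The map from a closed cell to the sphere *)

Definition distance i x : R := N * depth (cell i) x.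

Lemma distance_ge0 i x : barycentric x -> 0 <= distance i x.
Proof. by move=> [x0 _]; rewrite mulr_ge0 ?depth_ge0 // ltW. Qed.

Lemma distance_le1 i x : barycentric x -> distance i x <= 1.
Proof.
move=> [x0 <-]; rewrite /distance mulr_natl -(card_cell i) -sumr_const.
rewrite [leRHS](bigID (mem (cell i))) /= -[leLHS]addr0 lerD ?sumr_ge0 //.
by apply: ler_sum => v; exact: depth_le.
Qed.

Lemma distance_eq0 i x : barycentric x -> ~~ (cell i \subset supp x) -> distance i x = 0.
Proof. by move=> [x0 _]; rewrite -depth_eq0 // /distance => /eqP ->; rewrite mulr0. Qed.

Lemma distance_gt0 i x : barycentric x -> (0 < distance i x) = (cell i \subset supp x).
Proof. by move=> [x0 _]; rewrite pmulr_rgt0 ?depth_gt0. Qed.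

(** The factor [N] in [distance] makes it 1 at the barycenter of the cell, so the height falls from
    1 on the boundary to -1 at the barycenter. The factor in front of the other entries kills them
    on the boundary and off the cell. The coordinate at [phi i ord0] is determined by the others, as
    they sum to 1 on the cell; its slot holds the height. *)
Definition chart_vector i x : 'rV[R]_n.+1 :=
  \row_j if j == ord0 then 1 - 2 * distance i x
         else distance i x * (x (phi i j) - N^-1).

Lemma chart_vector_off i x : distance i x = 0 -> chart_vector i x = set_val base.
Proof.
move=> d0; apply/rowP => j; rewrite set_valE /= !mxE d0 eqxx.
by case: eqP => _; rewrite ?mulr0 ?subr0 ?mul0r.
Qed.

(** A zero height means distance 1/2, whereas the other zero entries, with the sum 1, force all
    coordinates to be [N^-1]: this is the barycenter, at distance 1. *)
Lemma chart_vector_neq0 i x : realization R K x -> chart_vector i x != 0.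
Proof.
move=> Kx; have bx := realization_barycentric Kx; have [x0 _] := bx.
apply/eqP => /rowP z0.
have d2 : distance i x = 2^-1 by have := z0 ord0; rewrite !mxE eqxx; lra.
have xi : cell i \subset supp x by rewrite -distance_gt0 // d2 invr_gt0.
have xj j : j != ord0 -> x (phi i j) = N^-1.
  move=> j0; have := z0 j; rewrite !mxE (negPf j0) => /eqP.
  by rewrite d2 mulf_eq0 invr_eq0 pnatr_eq0 /= subr_eq0 => /eqP.
have xN j : x (phi i j) = N^-1.
  have [->|/xj//] := eqVneq j ord0.
  have xs : supp x \subset cell i by rewrite (supp_cell Kx xi).
  have := sum_cell bx xs.
  rewrite (bigD1 ord0) //= (eq_bigr (fun=> N^-1)) => [|k /xj //].
  rewrite sumr_const cardC1 card_ord /= -[_ *+ n]mulr_natl => x01.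
  by apply: (addIr (n%:R * N^-1)); rewrite x01 -[X in X + _]mul1r -mulrDl nat1r divff.
have : depth (cell i) x = N^-1.
  have [v /imsetP[j _ ->] ->] :=
    depth_attained (fun v => barycentric_le1 v bx) (cell_neq0 i).
  exact: xN.
by move=> dN; move: d2; rewrite /distance dN divff // => d2; lra.
Qed.

Implicit Type z : 'rV[R]_n.+1.

(** * The map from the sphere back to the complex *)

Definition weight (z : 'rV[R]_n.+1) (j : 'I_n.+1) : R :=
  if j == ord0 then - \sum_(k | k != ord0) z ord0 k else z ord0 j.

Definition min_weight z : R := \big[Num.min/0]_j weight z j.

(** A point [N^-1 + weight z j / gauge z] has nonnegative coordinates iff the gauge is at least the
    first term, and with equality some coordinate is 0. The second term takes over at low heights
    and pulls the point inward, to the barycenter at the antipode of the base point. As the weights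
    sum to 0, the default 0 does not change their minimum. *)
Definition gauge z : R := Num.max (- (N * min_weight z)) (- z ord0 ord0).

(* The ray from the barycenter of the cell in the direction [weight z]; it
   reaches the boundary of the cell when [0 <= z ord0 ord0]. *)
Definition cell_point i z : V -> R := fun v =>
  \sum_j (N^-1 + weight z j / gauge z) * (phi i j == v)%:R.

Lemma cell_point_phi i z j : cell_point i z (phi i j) = N^-1 + weight z j / gauge z.
Proof.
rewrite /cell_point (bigD1 j) //= eqxx mulr1 big1 ?addr0 // => k kj.
by rewrite (inj_eq (@phi_inj i)) (negPf kj) mulr0.
Qed.

Lemma cell_point_supp i z : supp (cell_point i z) \subset cell i.
Proof.
apply/fintype.subsetP => v; rewrite inE; apply: contraNT => vi.
apply/eqP; rewrite /cell_point big1 // => j _; case: eqP => [jv|_]; last by rewrite mulr0.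
by move: vi; rewrite -jv mem_cell.
Qed.

Lemma sum_weight z : \sum_j weight z j = 0.
Proof.
rewrite (bigD1 ord0) //= {1}/weight eqxx (eq_bigr (z ord0)) ?addNr // => j.
by rewrite /weight => /negPf ->.
Qed.

Lemma min_weight_le z j : min_weight z <= weight z j.
Proof. exact: bigmin_le. Qed.

(** If both terms are nonpositive, the weights are nonnegative with sum 0, hence all zero. Then [z]
    is the base point or its antipode, and its nonnegative height leaves only the excluded base
    point. *)
Lemma gauge_gt0 z : sphere R n z -> z ord0 ord0 < 1 -> 0 < gauge z.
Proof.
move=> z1 z01; rewrite ltNge; apply/negP; rewrite ge_max => /andP[].
rewrite oppr_le0 pmulr_rge0 // => mu0; rewrite oppr_le0 => z00.
have w0 j : weight z j = 0.
  have wge0 k : true -> 0 <= weight z k by move=> _; exact: le_trans (min_weight_le z k).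
  exact: (psumr_eq0P wge0 (sum_weight z)).
have := z1; rewrite /sphere /= (bigD1 ord0) //= big1 => [|j j0]; last first.
  by have := w0 j; rewrite /weight (negPf j0) => ->; rewrite expr0n.
by rewrite addr0 => /eqP; rewrite sqrf_eq1 => /orP[] /eqP zE; lra.
Qed.

Lemma cell_point_realization i z : 0 < gauge z -> realization R K (cell_point i z).
Proof.
move=> g0; apply: realizationS (cell_simplex i) (cell_point_supp i z); split.
  move=> v; apply: sumr_ge0 => j _; apply: mulr_ge0; rewrite ?ler0n //.
  rewrite -(pmulr_lge0 _ g0) mulrDl mulfVK ?gt_eqF // -(pmulr_rge0 _ N_gt0) mulrDr.
  rewrite mulrA divff // mul1r.
  have : - (N * min_weight z) <= gauge z by rewrite le_max lexx.
  have : N * min_weight z <= N * weight z j by rewrite ler_pM2l // min_weight_le.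
  lra.
rewrite exchange_big /=.
transitivity (\sum_j (N^-1 + weight z j / gauge z)).
  apply: eq_bigr => j _; rewrite -mulr_sumr (bigD1 (phi i j)) //= eqxx.
  by rewrite big1 ?addr0 ?mulr1 // => v /negPf; rewrite eq_sym => ->.
rewrite big_split /= -mulr_suml sum_weight mul0r addr0 sumr_const card_ord.
by rewrite -[_ *+ _]mulr_natl divff.
Qed.

(** At nonnegative height the gauge is its first term, so the coordinate of least weight becomes
    exactly 0. *)
Lemma cell_point_off i z : 0 < gauge z -> 0 <= z ord0 ord0 ->
  off_cells (cell_point i z).
Proof.
move=> g0 z00; split; first exact: cell_point_realization.
move=> k; have [->|ki] := eqVneq k i; last first.
  by apply: cell_other ki _; exact: cell_point_supp.
have gE : gauge z = - (N * min_weight z).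
  apply/max_idPl; rewrite leNgt; apply/negP => lt_z.
  by move: g0; rewrite /gauge (max_idPr (ltW lt_z)) oppr_gt0 ltNge z00.
have mu0 : min_weight z < 0 by move: g0; rewrite gE oppr_gt0 pmulr_rlt0.
have [//|[j _ wj]] := bigmin_leP _ _ _ _ (lexx (min_weight z)).
  by rewrite leNgt mu0.
have {}wj : weight z j = min_weight z by apply/eqP; rewrite eq_le wj min_weight_le.
apply/fintype.subsetPn; exists (phi i j); first exact: mem_cell.
rewrite inE negbK cell_point_phi wj gE; apply/eqP; field.
by rewrite nat1r N_neq0 lt_eqF.
Qed.

(** The gauge vanishes at the base point, where [cell_point] is singular. The flow is therefore run
    at double speed, to finish at height 1/2 and leave a cap around the base point that is sent to
    [pt]. *)
Definition inverse_chart i z : V -> R :=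
  if 2^-1 <= z ord0 ord0 then pt else h (cell_point i z) (2 * z ord0 ord0).

(** The branches agree, since from height 1/2 on the flow has already ended at [pt]. *)
Lemma inverse_chartE i z : sphere R n z -> z ord0 ord0 < 1 ->
  inverse_chart i z = h (cell_point i z) (2 * z ord0 ord0).
Proof.
move=> z1 z01; rewrite /inverse_chart; case: ifP => // z02.
rewrite h_end //; last by lra.
by apply: cell_point_off; [exact: gauge_gt0|lra].
Qed.

Lemma inverse_chart_off i z : sphere R n z -> 0 <= z ord0 ord0 ->
  off_cells (inverse_chart i z).
Proof.
move=> z1 z0; rewrite /inverse_chart; case: ifP => // /negbT; rewrite -ltNge => z2.
by apply/h_off/cell_point_off => //; apply: gauge_gt0 => //; lra.
Qed.

Lemma inverse_chart_neg i z : z ord0 ord0 <= 0 ->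
  inverse_chart i z = cell_point i z.
Proof.
move=> z0; rewrite /inverse_chart h_le0; first by case: ifP => // z2; exfalso; lra.
by rewrite pmulr_rle0.
Qed.

Lemma inverse_chart_realization i z : sphere R n z ->
  realization R K (inverse_chart i z).
Proof.
move=> z1; have [z0|/ltW z0] := leP 0 (z ord0 ord0).
  by have [] := inverse_chart_off i z1 z0.
rewrite inverse_chart_neg //; apply: cell_point_realization.
by apply: gauge_gt0 => //; lra.
Qed.

Lemma inverse_chart_other i k z : sphere R n z -> k != i ->
  ~~ (cell k \subset supp (inverse_chart i z)).
Proof.
move=> z1 ki; have [z0|/ltW z0] := leP 0 (z ord0 ord0).
  by have [] := inverse_chart_off i z1 z0.
rewrite inverse_chart_neg //; apply: cell_other ki _; exact: cell_point_supp.
Qed.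

Lemma weight_cvg (T : topologicalType) (f : T -> 'rV[R]_n.+1) y j :
  (forall k, f s ord0 k @[s --> y] --> f y ord0 k) ->
  weight (f s) j @[s --> y] --> weight (f y) j.
Proof.
move=> cf; rewrite /weight; case: (j == ord0) => //; apply: cvgN.
by apply: sum_cvg => k _; exact: cf.
Qed.

Lemma gauge_cvg (T : topologicalType) (f : T -> 'rV[R]_n.+1) y :
  (forall k, f s ord0 k @[s --> y] --> f y ord0 k) ->
  gauge (f s) @[s --> y] --> gauge (f y).
Proof.
move=> cf; apply: max_cvg; apply: cvgN => //; apply: cvgM; first exact: cvg_cst.
by apply: bigmin_cvg => j _; exact: weight_cvg.
Qed.

Lemma cell_point_cvg (T : topologicalType) (f : T -> 'rV[R]_n.+1) i y v :
  (forall k, f s ord0 k @[s --> y] --> f y ord0 k) -> 0 < gauge (f y) ->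
  cell_point i (f s) v @[s --> y] --> cell_point i (f y) v.
Proof.
move=> cf g0; apply: sum_cvg => j _; apply: cvgM; last exact: cvg_cst.
apply: cvgD; first exact: cvg_cst.
apply: cvgM; first exact: weight_cvg.
by apply: cvgV; [rewrite gt_eqF|exact: gauge_cvg].
Qed.

(** Away from the base point, the single formula of [inverse_chartE] is continuous; near the base
    point the map is constant. *)
Lemma inverse_chart_cvg i (u : S) v :
  inverse_chart i (set_val s) v @[s --> u] --> inverse_chart i (set_val u) v.
Proof.
have cu k := @sphere_coord_continuous R n k u.
have [u1|u1] := ltP (coord (set_val u) ord0) 1.
  apply: (@near_cvg _ _ (fun s : S => inverse_chart i (set_val s) v)
      (fun s : S => h (cell_point i (set_val s)) (2 * coord (set_val s) ord0) v)).
    apply: filterS (near_lt (cu ord0) u1) => s s1.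
    by rewrite inverse_chartE //; exact: sphere_val.
  apply: h_cvg => [w|]; last by apply: mul_cvg; [exact: cst_cvg|exact: cu].
  by apply: cell_point_cvg => //; apply: gauge_gt0 => //; exact: sphere_val.
have u2 : 2^-1 < coord (set_val u) ord0 by lra.
apply: (@near_cvg _ _ (fun s : S => inverse_chart i (set_val s) v) (fun=> pt v));
  last exact: cst_cvg.
apply: filterS (near_gt (cu ord0) u2) => s s2.
by rewrite /inverse_chart (ltW s2).
Qed.

Lemma distance_cvg (T : topologicalType) (f : T -> V -> R) i y :
  (forall v, f s v @[s --> y] --> f y v) ->
  distance i (f s) @[s --> y] --> distance i (f y).
Proof. by move=> cf; apply: mul_cvg; [exact: cst_cvg|exact: depth_cvg]. Qed.

Definition chart i x : S := to_sphere (normalize (chart_vector i x)).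

Lemma chartE i x : realization R K x ->
  set_val (chart i x) = normalize (chart_vector i x).
Proof. by move=> /chart_vector_neq0 => /(_ i) /normalize_sphere; exact: to_sphereK. Qed.

Lemma chart_off i x : realization R K x -> ~~ (cell i \subset supp x) ->
  chart i x = base.
Proof.
move=> Kx ix; rewrite /chart chart_vector_off; last first.
  exact: distance_eq0 (realization_barycentric Kx) ix.
by rewrite normalize_id ?to_sphere_val //; exact: sphere_val.
Qed.

Lemma chart_cvg (T : topologicalType) (f : T -> V -> R) i y :
  (forall s, realization R K (f s)) -> (forall v, f s v @[s --> y] --> f y v) ->
  chart i (f s) @[s --> y] --> chart i (f y).
Proof.
move=> Kf cf; apply: to_sphere_cvg.
  by move=> s; apply/normalize_sphere/chart_vector_neq0.
apply: normalize_cvg; first exact: chart_vector_neq0.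
have cd := @distance_cvg _ _ i _ cf; apply: mx_cvg_coord => k j.
have [->|/negPf j0] := eqVneq j ord0.
  rewrite mxE eqxx (_ : (fun s => _) = (fun s => 1 - 2 * distance i (f s))).
    apply: add_cvg; first exact: cst_cvg.
    by apply: cvgN; apply: mul_cvg => //; exact: cst_cvg.
  by apply/funext => s; rewrite mxE eqxx.
rewrite mxE j0.
rewrite (_ : (fun s => _) = (fun s => distance i (f s) * (f s (phi i j) - N^-1))).
  by apply: mul_cvg => //; apply: add_cvg => //; exact: cst_cvg.
by apply/funext => s; rewrite mxE j0.
Qed.

(* [stretch] and [spread] give a formula for the composite of [chart] and
   [cell_point] that makes sense, and is continuous, off the cells as well. *)
Definition stretch i x : R :=
  Num.max (1 - distance i x) ((2 * distance i x - 1) / Num.max (distance i x) 2^-1).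

Definition spread x : V -> R := fun v =>
  x v + \sum_i ((stretch i x)^-1 - 1) * (x v - (v \in cell i)%:R / N).

Lemma stretch_gt0 i x : barycentric x -> 0 < stretch i x.
Proof.
move=> bx; have := distance_le1 i bx; rewrite le_eqVlt /stretch lt_max.
move=> /predU1P[-> |d1]; last by rewrite subr_gt0 d1.
by apply/orP; right; apply: divr_gt0; [lra|rewrite lt_max ltr01].
Qed.

Lemma stretch_off i x : distance i x = 0 -> stretch i x = 1.
Proof.
move=> d0; rewrite /stretch d0 subr0; apply/max_idPl.
by rewrite mulr0 sub0r mulN1r (@le_trans _ _ 0) // oppr_le0 invr_ge0 le_max lexx.
Qed.

Lemma spread_off x : off_cells x -> spread x = x.
Proof.
move=> [Kx xN]; apply/funext => v; rewrite /spread big1 ?addr0 // => i _.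
rewrite stretch_off ?invr1 ?subrr ?mul0r //.
exact: distance_eq0 (realization_barycentric Kx) (xN i).
Qed.

Lemma weightZ a z j : weight (a *: z) j = a * weight z j.
Proof.
rewrite /weight mxE; case: ifP => // _; rewrite mulrN mulr_sumr.
by congr (- _); apply: eq_bigr => k _; rewrite mxE.
Qed.

Lemma min_weightE z j : weight z j <= 0 -> (forall k, weight z j <= weight z k) ->
  min_weight z = weight z j.
Proof.
move=> j0 jk; apply/eqP; rewrite eq_le min_weight_le /=.
by apply/bigmin_geP; split.
Qed.

Lemma spread_cell i x : realization R K x -> cell i \subset supp x ->
  let z := normalize (chart_vector i x) in
  0 < gauge z /\ spread x = cell_point i z.
Proof.
move=> Kx ix z; have bx := realization_barycentric Kx.
have sx := supp_cell Kx ix; set d := distance i x.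
have d_gt0 : 0 < d by rewrite /d distance_gt0.
have d_le1 : d <= 1 by exact: distance_le1.
pose c := (Num.sqrt (sqnorm (chart_vector i x)))^-1.
have c_gt0 : 0 < c by rewrite invr_gt0 sqrt_sqnorm_gt0 // chart_vector_neq0.
have x1 : \sum_j x (phi i j) = 1 by apply: sum_cell; rewrite ?sx.
have wE j : weight z j = c * (d * (x (phi i j) - N^-1)).
  rewrite weightZ -/c; congr (_ * _); rewrite /weight.
  case: eqP => [->|/eqP/negPf j0]; last by rewrite mxE j0.
  rewrite (eq_bigr (fun k => d * (x (phi i k) - N^-1))) => [|k /negPf k0]; last first.
    by rewrite mxE k0.
  have : \sum_k d * (x (phi i k) - N^-1) = 0.
    rewrite -mulr_sumr sumrB x1 sumr_const card_ord -[_ *+ _]mulr_natl divff //.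
    by rewrite subrr mulr0.
  by rewrite (bigD1 ord0) //= => /eqP; rewrite addr_eq0 => /eqP ->.
(* The vertex with the least coordinate, which is [d / N], also has the least weight; this computes
   the gauge. *)
have [_ /imsetP[j0 _ ->] xj0] :=
  depth_attained (fun v => barycentric_le1 v bx) (cell_neq0 i).
have xE : x (phi i j0) = d / N by rewrite -xj0 /d /distance mulrAC divff // mul1r.
have muE : N * min_weight z = - (c * (d * (1 - d))).
  rewrite (@min_weightE _ j0) wE xE; first by field; rewrite nat1r.
    by rewrite pmulr_rle0 // pmulr_rle0 // subr_le0 ler_piMl.
  by move=> k; rewrite wE !ler_pM2l // lerD2r -xE -xj0 depth_le // mem_cell.
(* Dividing the two terms of the gauge by [c * d] gives [1 - d] and [(2 * d - 1) / d]. For [d] below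
   1/2 the second is nonpositive, so replacing its denominator by 1/2 does not alter the maximum. *)
have gE : gauge z = c * d * stretch i x.
  rewrite /gauge muE opprK mxE -/c mxE eqxx -/d /stretch -/d.
  have [d2|d2] := leP 2^-1 d.
    rewrite maxr_pMr; last by rewrite mulr_ge0 // ltW.
    rewrite mulrA (_ : c * d * ((2 * d - 1) / d) = - (c * (1 - 2 * d))) //.
    by field; rewrite gt_eqF.
  have neg_le : - (c * (1 - 2 * d)) <= c * (d * (1 - d)).
    rewrite -mulrN ler_pM2l //; apply: (@le_trans _ _ 0); first lra.
    by apply: mulr_ge0; lra.
  rewrite (max_idPl neg_le) mulrA; congr (_ * _); apply/esym/max_idPl.
  by lra.
have s_gt0 := stretch_gt0 i bx.
have g_gt0 : 0 < gauge z by rewrite gE; apply: mulr_gt0 => //; exact: mulr_gt0.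
split=> //; apply/funext => v; rewrite /spread (bigD1 i) //= big1 ?addr0; last first.
  move=> k ki; rewrite stretch_off ?invr1 ?subrr ?mul0r //.
  by apply: distance_eq0 => //; rewrite sx; exact: cell_other ki (fintype.subxx _).
have [/imsetP[j _ ->]|vi] := boolP (v \in cell i); last first.
  have := fintype.subsetP (cell_point_supp i z) v; rewrite inE (negPf vi).
  case: eqP => [-> _|_ /(_ isT)//].
  have : v \notin supp x by rewrite sx.
  by rewrite inE negbK => /eqP ->; rewrite mul0r subr0 mulr0 addr0.
rewrite cell_point_phi wE gE /=.
by field; rewrite nat1r N_neq0 !gt_eqF.
Qed.

Lemma stretch_cvg (T : topologicalType) (f : T -> V -> R) i y :
  (forall v, f s v @[s --> y] --> f y v) ->
  stretch i (f s) @[s --> y] --> stretch i (f y).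
Proof.
move=> cf; have cd := @distance_cvg _ _ i _ cf; apply: max_cvg.
  by apply: add_cvg; [exact: cst_cvg|exact: cvgN].
apply: mul_cvg.
  by apply: add_cvg; [apply: mul_cvg => //; exact: cst_cvg|exact: cst_cvg].
apply: cvgV; last by apply: max_cvg => //; exact: cst_cvg.
by rewrite gt_eqF // lt_max invr_gt0 ltr0n orbT.
Qed.

Lemma spread_cvg (T : topologicalType) (f : T -> V -> R) y v :
  barycentric (f y) -> (forall v, f s v @[s --> y] --> f y v) ->
  spread (f s) v @[s --> y] --> spread (f y) v.
Proof.
move=> by_ cf; apply: add_cvg => //; apply: sum_cvg => i _; apply: mul_cvg.
  apply: add_cvg; last exact: cst_cvg.
  by apply: cvgV; [rewrite gt_eqF ?stretch_gt0|exact: stretch_cvg].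
by apply: add_cvg => //; exact: cst_cvg.
Qed.

(** * The maps between the realization and the wedge *)

Let ptX : X := exist (fun x => x \in realization R K) pt (mem_set pt_off.1).

Definition to_realization (x : V -> R) : X := insubd ptX (x : {ptws V -> R}).

Lemma to_realizationK x : realization R K x -> set_val (to_realization x) = x.
Proof. by move=> Kx; rewrite set_valE /to_realization insubdK //; exact/mem_set. Qed.

Lemma to_realization_val (u : X) : to_realization (set_val u) = u.
Proof. by rewrite /to_realization set_valE valKd. Qed.

Lemma realization_val (u : X) : realization R K (set_val u).
Proof. exact: set_valP. Qed.

Lemma to_realization_cvg (T : topologicalType) (f : T -> V -> R) y :
  (forall s, realization R K (f s)) -> (forall v, f s v @[s --> y] --> f y v) ->
  to_realization (f s) @[s --> y] --> to_realization (f y).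
Proof.
move=> Kf cf; apply: set_type_cvg; rewrite to_realizationK //.
rewrite (_ : (fun s => _) = f); first exact: ptws_cvg_coord.
by apply/funext => s; exact: to_realizationK.
Qed.

Lemma realization_coord_continuous v : continuous (fun u : X => (set_val u : V -> R) v).
Proof.
move=> u; apply: (@continuous_comp _ _ _ (set_val : X -> {ptws V -> R})
  (fun x : {ptws V -> R} => x v)); first exact: initial_continuous.
exact: (@proj_continuous _ (fun=> R) v).
Qed.

Local Notation lift i u := (@wedge_lift _ (fun=> S) (fun=> base) i u).

Lemma lift_base i k : lift i base = lift k base.
Proof. exact: (@wedge_liftE _ _ (fun=> base) k base i base). Qed.

Definition collapse_map (x : X) : W :=
  if [pick i | cell i \subset supp (set_val x)] is Some i
  then lift i (chart i (set_val x)) else lift ord0 base.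

(** If [x] is not in the open cell [i] either, its chart is the base point, and all base points are
    identified in the wedge. This frees continuity proofs from the choice made by [pick]. *)
Lemma collapse_mapE (x : X) i :
  (forall k, k != i -> ~~ (cell k \subset supp (set_val x))) ->
  collapse_map x = lift i (chart i (set_val x)).
Proof.
move=> xi; rewrite /collapse_map; case: pickP => [k xk|x0].
  by have [->//|/xi] := eqVneq k i; rewrite xk.
rewrite chart_off ?x0 //; last exact: realization_val.
exact: lift_base.
Qed.

Lemma collapse_map_lift (x : X) :
  exists2 i, forall k, k != i -> ~~ (cell k \subset supp (set_val x)) &
             collapse_map x = lift i (chart i (set_val x)).
Proof.
have [[i xi]|/forallNP xN] := pselect (exists i, cell i \subset supp (set_val x)).
  exists i; last apply: collapse_mapE; move=> k; apply: contraNN => xk;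
  by apply/eqP; exact: cell_uniq (realization_val x) xk xi.
by exists ord0; last apply: collapse_mapE; move=> k _; exact/negP.
Qed.

Lemma near_cell (x : X) i : cell i \subset supp (set_val x) ->
  \forall y \near x, cell i \subset supp (set_val (y : X)).
Proof.
have cd : distance i (set_val (y : X)) @[y --> x] --> distance i (set_val x).
  by apply: distance_cvg => v; exact: realization_coord_continuous.
rewrite -distance_gt0; last exact: realization_barycentric (realization_val x).
move=> /(near_gt cd); apply: filterS => y; rewrite distance_gt0 //.
exact: realization_barycentric (realization_val y).
Qed.

Lemma lift_chart_cvg i (x : X) :
  lift i (chart i (set_val y)) @[y --> x] --> lift i (chart i (set_val x)).
Proof.
apply: (@continuous_comp _ _ _ (fun y : X => chart i (set_val y))
  (fun u => lift i u)); last exact: wedge_lift_continuous.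
apply: chart_cvg => [s|v]; first exact: realization_val.
exact: realization_coord_continuous.
Qed.

Lemma collapse_map_continuous : continuous collapse_map.
Proof.
move=> x; have [i xi fx] := collapse_map_lift x.
have [xci|xNi] := boolP (cell i \subset supp (set_val x)).
  apply: (@near_cvg _ _ collapse_map (fun y : X => lift i (chart i (set_val y)))).
    apply: filterS (near_cell xci) => y yi; apply: collapse_mapE => k.
    apply: contraNN => yk; apply/eqP.
    exact: cell_uniq (realization_val y) yk yi.
  exact: lift_chart_cvg.
have x_off k : ~~ (cell k \subset supp (set_val x)).
  by have [->//|/xi] := eqVneq k i.
move=> U fxU.
(* Outside all open cells, nearby points may lie in any cell. Every chart sends [x] to the common
   base point, so finitely many charts map a common neighborhood into [U]. *)
have near_all : \forall y \near x, forall k, U (lift k (chart k (set_val (y : X)))).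
  apply: near_forall => k; apply: (@lift_chart_cvg k).
  rewrite chart_off //; last exact: realization_val.
  move: fxU; rewrite fx chart_off //; last exact: realization_val.
  by rewrite (lift_base i k).
apply: filterS near_all => y Uy.
by have [k _ yE] := collapse_map_lift y; have := Uy k; rewrite -yE.
Qed.

Definition cell_map i (u : S) : X := to_realization (inverse_chart i (set_val u)).

Lemma cell_map_val i u : set_val (cell_map i u) = inverse_chart i (set_val u).
Proof. by rewrite to_realizationK //; apply: inverse_chart_realization; exact: sphere_val. Qed.

Lemma cell_map_continuous i : continuous (cell_map i).
Proof.
move=> u; apply: to_realization_cvg => [s|v]; last exact: inverse_chart_cvg.
by apply: inverse_chart_realization; exact: sphere_val.
Qed.

Lemma inverse_chart_base i : inverse_chart i (set_val base) = pt.
Proof. by rewrite /inverse_chart sphere_point_coord ifT //; lra. Qed.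

Lemma cell_map_base i k : cell_map i base = cell_map k base.
Proof. by rewrite /cell_map !inverse_chart_base. Qed.

Definition wedge_map : W -> X := wedge_fun cell_map.

Lemma wedge_map_lift i u : wedge_map (lift i u) = cell_map i u.
Proof. by rewrite /wedge_map wedge_lift_funE //; exact: cell_map_base. Qed.

Lemma wedge_map_continuous : continuous wedge_map.
Proof.
by apply: wedge_fun_continuous; [exact: cell_map_continuous|exact: cell_map_base].
Qed.

(** * The homotopy on the realization *)

Definition height : W -> R := wedge_fun (fun (_ : 'I_m.+1) (u : S) => coord (set_val u) ord0).

Lemma height_lift i u : height (lift i u) = coord (set_val u) ord0.
Proof. by rewrite /height wedge_lift_funE. Qed.

(** All base points have first coordinate 1, so the coordinates glue; composed with [collapse_map],
    the height gives a continuous flow time on the whole realization. *)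
Lemma height_continuous : continuous height.
Proof. by apply: wedge_fun_continuous => // _; exact: sphere_coord_continuous. Qed.

(* First every point is pushed along [spread] within its cell, then the part of
   the cells that has reached their boundary follows the contraction [h]. *)
Definition collapse_homotopy (s t : R) (x : X) : V -> R :=
  h (fun v => set_val x v + s * (spread (set_val x) v - set_val x v))
    (t * (2 * height (collapse_map x))).

Lemma segment_barycentric x y s : 0 <= s <= 1 -> barycentric x -> barycentric y ->
  barycentric (fun v => x v + s * (y v - x v)).
Proof.
move=> /andP[s0 s1] [x0 x1] [y0 y1]; split=> [v|].
  rewrite (_ : _ + _ = (1 - s) * x v + s * y v); last by ring.
  by rewrite addr_ge0 // mulr_ge0 // subr_ge0.
by rewrite big_split /= -mulr_sumr sumrB x1 y1 subrr mulr0 addr0.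
Qed.

Lemma spread_segment (x : X) s : 0 <= s <= 1 ->
  realization R K (fun v => set_val x v + s * (spread (set_val x) v - set_val x v)).
Proof.
move=> s01; have Kx := realization_val x.
have [[i xi]|/forallNP xN] := pselect (exists i, cell i \subset supp (set_val x)).
  have [g0 ->] := spread_cell Kx xi.
  have Kp := cell_point_realization i g0.
  apply: realizationS (cell_simplex i) _.
    by apply: segment_barycentric => //; exact: realization_barycentric.
  apply/fintype.subsetP => v; rewrite inE; apply: contraNT => vi.
  have : v \notin supp (set_val x) by rewrite (supp_cell Kx xi).
  rewrite inE negbK => /eqP ->.
  have : v \notin supp (cell_point i (normalize (chart_vector i (set_val x)))).
    by apply: contra vi => /(fintype.subsetP (cell_point_supp _ _)).
  by rewrite inE negbK => /eqP ->; rewrite subrr mulr0 addr0.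
rewrite spread_off; last by split=> // i; exact/negP.
by rewrite (_ : (fun v => _) = set_val x) //; apply/funext => v; rewrite subrr mulr0 addr0.
Qed.

(** The flow is known to stay in the complex only off the open cells. It has positive time only at
    positive height, and there the completed [spread] has brought a point of an open cell to the
    boundary. *)
Lemma collapse_homotopy_realization (s t : R) (x : X) : 0 <= s <= 1 -> 0 <= t ->
  t = 0 \/ s = 1 -> realization R K (collapse_homotopy s t x).
Proof.
move=> s01 t0 ts; rewrite /collapse_homotopy; have Kx := realization_val x.
have [le0|gt0] := leP (t * (2 * height (collapse_map x))) 0.
  by rewrite h_le0 //; exact: spread_segment.
case: ts gt0 => [->|->] gt0; first by rewrite mul0r ltxx in gt0.
rewrite (_ : (fun v => _) = spread (set_val x)); last first.
  by apply/funext => v; rewrite mul1r addrC subrK.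
suff off : off_cells (spread (set_val x)).
  by have [] := h_off (t * (2 * height (collapse_map x))) off.
have [[i xi]|/forallNP xN] := pselect (exists i, cell i \subset supp (set_val x)).
  have [g0 ->] := spread_cell Kx xi; apply: cell_point_off => //.
  move: gt0; rewrite (@collapse_mapE _ i) => [|k]; last first.
    by apply: contraNN => xk; apply/eqP; exact: cell_uniq Kx xk xi.
  rewrite height_lift chartE // => gt0; rewrite leNgt; apply/negP => z0.
  by move: gt0; rewrite ltNge mulr_ge0_le0 // pmulr_rle0 // ltW.
by rewrite spread_off; split=> // i; exact/negP.
Qed.

Lemma collapse_homotopy1 (x : X) :
  collapse_homotopy 1 1 x = set_val (wedge_map (collapse_map x)).
Proof.
rewrite /collapse_homotopy mul1r; have Kx := realization_val x.
rewrite (_ : (fun v => _) = spread (set_val x)); last first.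
  by apply/funext => v; rewrite mul1r addrC subrK.
have [[i xi]|/forallNP xN] := pselect (exists i, cell i \subset supp (set_val x)).
  rewrite (@collapse_mapE _ i) => [|k]; last first.
    by apply: contraNN => xk; apply/eqP; exact: cell_uniq Kx xk xi.
  rewrite height_lift wedge_map_lift cell_map_val chartE // /inverse_chart.
  have [g0 ->] := spread_cell Kx xi; case: ifP => // z2.
  by rewrite h_end //; [apply: cell_point_off => //|]; lra.
have x_off : off_cells (set_val x) by split=> // i; exact/negP.
have [i _ ->] := collapse_map_lift x.
rewrite chart_off ?x_off.2 // height_lift wedge_map_lift cell_map_val.
rewrite inverse_chart_base sphere_point_coord spread_off // h_end //; lra.
Qed.

Lemma wedge_map_collapse_map : homotopic R (wedge_map \o collapse_map) id.
Proof.
(* Time leads from the composite to the identity, so the stages are run backwards: [t] falls from 1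
   to 0 on the first half with [s = 1], then [s] falls from 1 to 0 with [t = 0]. *)
exists (fun p : X * R => to_realization
  (collapse_homotopy (clamp (2 - 2 * p.2)) (clamp (1 - 2 * p.2)) p.1)); split.
- apply: continuous_subspaceT => p.
  have c2 : continuous (fun q : X * R => q.2) by move=> q; exact: cvg_snd.
  have cv v : continuous (fun q : X * R => (set_val q.1 : V -> R) v).
    move=> q; apply: (@continuous_comp _ _ _ fst (fun u : X => (set_val u : V -> R) v)).
      exact: cvg_fst.
    exact: realization_coord_continuous.
  apply: to_realization_cvg => [q|].
    apply: collapse_homotopy_realization; rewrite ?clamp_ge0 ?clamp_le1 //.
    have [q2|q2] := leP q.2 2^-1; last by left; apply: clamp_le0; lra.
    by right; apply: clamp_ge1; lra.
  have caff (a : R) q : a - 2 * q'.2 @[q' --> (q : X * R)] --> a - 2 * q.2.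
    apply: add_cvg; first exact: cst_cvg.
    by apply: cvgN; apply: mul_cvg; [exact: cst_cvg|exact: c2].
  have ch : height (collapse_map q.1) @[q --> p] --> height (collapse_map p.1).
    apply: (@continuous_comp _ _ _ (fun q : X * R => collapse_map q.1) height).
      apply: (@continuous_comp _ _ _ fst collapse_map); first exact: cvg_fst.
      exact: collapse_map_continuous.
    exact: height_continuous.
  apply: h_cvg => [v|].
    apply: add_cvg; first exact: cv.
    apply: mul_cvg; first by apply: clamp_cvg; exact: caff.
    apply: add_cvg; last by apply: cvgN; exact: cv.
    apply: spread_cvg => [|w]; last exact: cv.
    exact: realization_barycentric (realization_val _).
  apply: mul_cvg; first by apply: clamp_cvg; exact: caff.
  by apply: mul_cvg => //; exact: cst_cvg.
- move=> x /=; rewrite mulr0 !subr0 (@clamp_ge1 _ 2) ?ler1n // clamp_ge1 //.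
  by rewrite collapse_homotopy1 to_realization_val.
- move=> x /=; rewrite (@clamp_le0 _ (2 - _)); last by lra.
  rewrite (@clamp_le0 _ (1 - _)); last by lra.
  rewrite /collapse_homotopy mul0r h_le0 // (_ : (fun v => _) = set_val x).
    exact: to_realization_val.
  by apply/funext => v; rewrite mul0r addr0.
Qed.

(** * The homotopy on the wedge *)

Definition sphere_map i (u : S) : S := chart i (set_val (cell_map i u)).

Lemma sphere_map_base i : sphere_map i base = base.
Proof.
rewrite /sphere_map chart_off //; first exact: realization_val.
by rewrite cell_map_val inverse_chart_base; case: pt_off.
Qed.

Lemma collapse_map_wedge_map i u :
  collapse_map (wedge_map (lift i u)) = lift i (sphere_map i u).
Proof.
rewrite wedge_map_lift; apply: collapse_mapE => k ki.
by rewrite cell_map_val inverse_chart_other //; exact: sphere_val.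
Qed.

(** At positive height the image is the base point, whose antipode has height -1. Otherwise all
    entries except the height are multiplied by a nonnegative factor, so an antipodal image forces
    them to vanish. Then [u] is the antipode of the base point, which goes to the barycenter and
    back to itself. *)
Lemma sphere_map_antipode i u : (set_val (sphere_map i u) : 'rV[R]_n.+1) != - set_val u.
Proof.
have Su := sphere_val u; have Kg := realization_val (cell_map i u).
apply/eqP => uE; have [u0|u0] := ltP 0 (coord (set_val u) ord0).
  have := uE; rewrite /sphere_map chart_off //; last first.
    by rewrite cell_map_val; have [_] := inverse_chart_off i Su (ltW u0).
  move=> /rowP/(_ ord0); rewrite sphere_point_coord mxE; lra.
have gu : 0 < gauge (set_val u) by apply: gauge_gt0 => //; lra.
have gE : (set_val (cell_map i u) : V -> R) = cell_point i (set_val u).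
  by rewrite cell_map_val inverse_chart_neg.
move: uE; rewrite /sphere_map chartE // gE /normalize.
set z := set_val u; set d := distance i (cell_point i z).
set c := (Num.sqrt _)^-1 => uE.
have Kp := cell_point_realization i gu.
have d0 : 0 <= d by apply: distance_ge0; exact: realization_barycentric.
have c0 : 0 < c by rewrite invr_gt0 sqrt_sqnorm_gt0 // chart_vector_neq0.
have z_eq0 j : j != ord0 -> z ord0 j = 0.
  move=> j0; have /rowP/(_ j) := uE; rewrite !mxE (negPf j0) cell_point_phi -/d.
  rewrite /weight (negPf j0) addrAC subrr add0r => /eqP; rewrite -addr_eq0.
  rewrite (_ : _ + _ = (c * (d / gauge z) + 1) * z ord0 j); last by ring.
  rewrite mulf_eq0 gt_eqF; first by move=> /eqP.
  rewrite ltr_wpDl //; apply: mulr_ge0; first exact: ltW.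
  by apply: divr_ge0 => //; exact: ltW.
have z0 : z ord0 ord0 = -1.
  have := Su; rewrite /sphere /= (bigD1 ord0) //= big1 => [|j /z_eq0 ->]; last first.
    by rewrite expr0n.
  by rewrite addr0 => /eqP; rewrite sqrf_eq1 => /orP[] /eqP zE; [move: u0; rewrite zE; lra|].
have d1 : d = 1.
  have pE j : cell_point i z (phi i j) = N^-1.
    rewrite cell_point_phi /weight; case: ifP => [_|/negbT /z_eq0 ->].
      by rewrite big1 ?oppr0 ?mul0r ?addr0.
    by rewrite mul0r addr0.
  rewrite /d /distance; have bp := realization_barycentric Kp.
  have [_ /imsetP[j _ ->] ->] :=
    depth_attained (fun v => barycentric_le1 v bp) (cell_neq0 i).
  by rewrite pE divff.
by have /rowP/(_ ord0) := uE; rewrite !mxE eqxx -/d d1 z0; lra.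
Qed.

Definition sphere_homotopy (t : R) i (u : S) : 'rV[R]_n.+1 :=
  (1 - clamp t) *: set_val (sphere_map i u) + clamp t *: set_val u.

Lemma sphere_homotopy_neq0 t i u : sphere_homotopy t i u != 0.
Proof.
apply: segment_neq0; [exact: sphere_val|exact: sphere_val|exact: sphere_map_antipode|].
by rewrite clamp_ge0 clamp_le1.
Qed.

Lemma sphere_homotopy_base t i : sphere_homotopy t i base = set_val base.
Proof. by rewrite /sphere_homotopy sphere_map_base -scalerDl subrK scale1r. Qed.

Lemma sphere_map_continuous i : continuous (sphere_map i).
Proof.
move=> u; apply: chart_cvg => [s|v]; first exact: realization_val.
apply: (@continuous_comp _ _ _ (cell_map i) (fun x : X => (set_val x : V -> R) v)).
  exact: cell_map_continuous.
exact: realization_coord_continuous.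
Qed.

Lemma sphere_homotopy_continuous i :
  continuous (fun p : R * S => to_sphere (normalize (sphere_homotopy p.1 i p.2))).
Proof.
move=> p; apply: to_sphere_cvg.
  by move=> q; apply/normalize_sphere/sphere_homotopy_neq0.
apply: normalize_cvg; first exact: sphere_homotopy_neq0.
have c1 q : clamp q'.1 @[q' --> (q : R * S)] --> clamp q.1.
  by apply: clamp_cvg; exact: cvg_fst.
apply: mx_cvg_coord => k j; rewrite ord1.
rewrite (_ : (fun q : R * S => _) = (fun q => (1 - clamp q.1) *
  coord (set_val (sphere_map i q.2)) j + clamp q.1 * coord (set_val q.2) j)); last first.
  by apply/funext => q; rewrite !mxE.
rewrite (_ : sphere_homotopy _ _ _ _ _ = (1 - clamp p.1) *
  coord (set_val (sphere_map i p.2)) j + clamp p.1 * coord (set_val p.2) j); last first.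
  by rewrite !mxE.
apply: add_cvg; apply: mul_cvg.
- by apply: add_cvg; [exact: cst_cvg|apply: cvgN; exact: c1].
- apply: (@continuous_comp _ _ _ (fun q : R * S => sphere_map i q.2)
    (fun u : S => coord (set_val u) j)); last exact: sphere_coord_continuous.
  apply: (@continuous_comp _ _ _ snd (sphere_map i)); first exact: cvg_snd.
  exact: sphere_map_continuous.
- exact: c1.
- apply: (@continuous_comp _ _ _ snd (fun u : S => coord (set_val u) j)).
    exact: cvg_snd.
  exact: sphere_coord_continuous.
Qed.

Lemma collapse_map_wedge_map_homotopic : homotopic R (collapse_map \o wedge_map) id.
Proof.
pose k i (t : R) (u : S) : W := lift i (to_sphere (normalize (sphere_homotopy t i u))).
have kE t i j : k i t base = k j t base.
  rewrite /k !sphere_homotopy_base normalize_id; last exact: sphere_val.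
  by rewrite to_sphere_val; exact: lift_base.
have liftP (w : W) : exists i u, w = lift i u.
  have [i _ [u _ <-]] : (\bigcup_i (@wedge_lift _ (fun=> S) (fun=> base) i) @` setT) w.
    by rewrite wedgeTE.
  by exists i, u.
(* Joint continuity in time and point passes from the spheres to the wedge because there are
   finitely many of them and their base points are closed. Time is the first factor here, hence the
   swap below. *)
have ck : continuous (uncurry (fun t => @wedge_fun _ _ (fun=> base) _ (k^~ t))).
  apply: wedge_fun_joint_continuous => //; first exact: finite_finset.
  - by move=> i; exact: closed_sphere_point.
  - move=> i; rewrite (_ : uncurry _ = (fun u => lift i u) \o
      (fun p : R * S => to_sphere (normalize (sphere_homotopy p.1 i p.2)))).
      move=> p; apply: continuous_comp; first exact: sphere_homotopy_continuous.
      exact: wedge_lift_continuous.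
    by apply/funext => -[].
exists (fun p : W * R => wedge_fun (k^~ p.2) p.1); split.
- apply: continuous_subspaceT => p.
  apply: (@continuous_comp _ _ _ (fun q : W * R => (q.2, q.1))
    (uncurry (fun t => @wedge_fun _ _ (fun=> base) _ (k^~ t)))); last exact: ck.
  exact: swap_continuous.
- move=> w; have [i [u ->]] := liftP w; rewrite /= collapse_map_wedge_map.
  rewrite wedge_lift_funE // /k /sphere_homotopy clamp_le0 // subr0 scale1r scale0r addr0.
  by rewrite normalize_id ?to_sphere_val //; exact: sphere_val.
- move=> w; have [i [u ->]] := liftP w.
  rewrite wedge_lift_funE // /k /sphere_homotopy clamp_ge1 // subrr scale1r scale0r add0r.
  by rewrite normalize_id ?to_sphere_val //; exact: sphere_val.
Qed.

Lemma attached_cells_homotopy_equivalent : homotopy_equivalent R X W.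
Proof.
exists collapse_map, wedge_map; split.
- exact: collapse_map_continuous.
- exact: wedge_map_continuous.
- exact: wedge_map_collapse_map.
- exact: collapse_map_wedge_map_homotopic.
Qed.

End CellAttachment.

(** * Verification of collapses on an encoded complex *)

Section Encoding.
Variables (V : finType) (T : eqType) (c : T -> V) (U : seq T).
Hypothesis c_inj : {in U &, injective c}.
Hypothesis c_surj : forall v, exists2 p, p \in U & v = c p.
Implicit Types (F : seq (seq T)) (f t : seq T).

(** Sets of vertices are represented by lists over [T], on which the inclusions needed for a
    collapse can be decided by computation. *)
Definition encode f : {set V} := [set v in [seq c p | p <- f]]%SET.

Lemma encode_subP f (s : {set V}) :
  reflect {in f, forall p, c p \in s} (encode f \subset s).
Proof.
apply: (iffP fintype.subsetP) => [fs p pf|fs v].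
  by apply: fs; rewrite inE map_f.
by rewrite inE => /mapP[p pf ->]; exact: fs.
Qed.

Lemma mem_encode f p : {subset f <= U} -> p \in U -> (c p \in encode f) = (p \in f).
Proof.
move=> fU pU; rewrite inE; apply/mapP/idP => [[q qf]|pf]; last by exists p.
by move=> /c_inj ->//; exact: fU.
Qed.

(* It is enough to look at the smallest face containing [a.1] whose
   enlargement by [a.2] would contain a given forbidden set. *)
Definition free_faceb F (a : seq T * T) : bool :=
  [&& a.1 != [::], a.2 \notin a.1, a.2 \in U, all (mem U) a.1 &
      all (fun f => (a.2 \in f) ==>
        has (fun f' => all (mem (a.1 ++ [seq p <- f | p != a.2])) f') F) F].

Definition encode_step (a : seq T * T) := (encode a.1, c a.2).

Lemma free_faceP F a : all (all (mem U)) F -> free_faceb F a ->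
  free_face [seq encode f | f <- F] (encode_step a).
Proof.
move=> FU /and5P[a0 aN aU a1U /allP aF].
split=> /=.
- case: a.1 a0 => // p t _; apply/finset.set0Pn; exists (c p).
  by rewrite !inE eqxx.
- by rewrite mem_encode //; apply/allP.
move=> s /allP Fs /encode_subP as_; apply/allP => _ /mapP[f fF ->].
apply/negP => /encode_subP fs.
have sub_s p : p \in f -> p != a.2 -> c p \in s.
  move=> pf pa; have := fs p pf; rewrite !inE => /predU1P[/c_inj pa2|//].
  by rewrite pa2 ?eqxx // in pa; exact: (allP (allP FU f fF)).
(* A forbidden [f] without the apex would already lie in [s]. With the apex, the check supplies a
   forbidden [f'] made of [a.1] and the rest of [f], both of which lie in [s]. *)
have [a2f|a2f] := boolP (a.2 \in f); last first.
  have /negP[] := Fs _ (map_f encode fF).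
  by apply/encode_subP => p pf; apply: sub_s => //; apply: contraNneq a2f => <-.
have /hasP[f' f'F /allP f'sub] := implyP (aF f fF) a2f.
have /negP[] := Fs _ (map_f encode f'F).
apply/encode_subP => p /f'sub /=; rewrite mem_cat mem_filter => /orP[/as_//|].
by move=> /andP[pa pf]; exact: sub_s.
Qed.

Fixpoint collapsesb F (l : seq (seq T * T)) (v0 : T) : bool :=
  if l is a :: l' then free_faceb F a && collapsesb (a.1 :: F) l' v0
  else all (fun p => (p == v0) || ([:: p] \in F)) U.

Lemma collapsesP F l v0 : all (all (mem U)) F -> collapsesb F l v0 ->
  collapses [seq encode f | f <- F] [seq encode_step a | a <- l] (c v0).
Proof.
elim: l F => [|a l IHl] F FU /= => [/allP UF s /allP Fs|/andP[aF cl]].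
  apply/fintype.subsetP => v vs; have [p pU vE] := c_surj v; rewrite inE vE.
  have /orP[/eqP->//|pF] := UF p pU.
  have /negP[] := Fs _ (map_f encode pF).
  by apply/encode_subP => q; rewrite mem_seq1 => /eqP ->; rewrite -vE.
split; first exact: free_faceP.
by apply: (IHl (a.1 :: F)) => //=; rewrite FU andbT; case/and5P: aF.
Qed.

End Encoding.

(** * The complex D_{5,2} *)

Section CompleteGraph5.
Local Open Scope nat_scope.

Definition pairs : seq (nat * nat) :=
  [seq p <- [seq (i, j) | i <- iota 0 5, j <- iota 0 5] | p.1 < p.2].

Definition star v := [seq p <- pairs | (p.1 == v) || (p.2 == v)].

Definition stars := [seq star v | v <- iota 0 5].

Definition costar v := [seq p <- pairs | (p.1 != v) && (p.2 != v)].

Lemma mem_pairs p : (p \in pairs) = (p.1 < p.2 < 5).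
Proof.
rewrite mem_filter; case p12: (p.1 < p.2) => //; rewrite andTb.
apply/allpairsPdep/idP => [[i [j [_ + ->]]]|p2]; first by rewrite mem_iota.
by exists p.1, p.2; rewrite !mem_iota (ltn_trans p12 p2) p2; case: (p).
Qed.

Lemma edge_pair_subproof : #|[set inord 0; inord 1 : 'I_5]%SET| == 2.
Proof. by rewrite cards2 -val_eqE /= !inordK. Qed.

Definition edge_of (p : nat * nat) : edge 5 :=
  insubd (exist (fun e : {set 'I_5} => #|e| == 2) _ edge_pair_subproof)
    [set inord p.1; inord p.2]%SET.

Lemma val_edge_of p : p \in pairs ->
  val (edge_of p) = [set inord p.1; inord p.2]%SET.
Proof.
rewrite mem_pairs => /andP[p12 p2]; have p1 := ltn_trans p12 p2.
by rewrite /edge_of insubdK // -topredE /= cards2 -val_eqE /= !inordK // (ltn_eqF p12).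
Qed.

Lemma edge_of_inj : {in pairs &, injective edge_of}.
Proof.
move=> [i j] [k l] ij kl /(congr1 val); rewrite !val_edge_of //=.
move: ij kl; rewrite !mem_pairs /= => /andP[ij j5] /andP[kl l5] /setP e.
have i5 := ltn_trans ij j5; have k5 := ltn_trans kl l5.
have := e (inord i); have := e (inord j); rewrite !inE !eqxx ?orbT /=.
rewrite -!val_eqE /= !inordK // => /esym/orP[]/eqP jE /esym/orP[]/eqP iE.
all: by congr pair; lia.
Qed.

Lemma edge_of_surj v : exists2 p, p \in pairs & v = edge_of p.
Proof.
have /cards2P[x [y [xy vE]]] := valP v.
wlog {xy} xy : x y vE / x < y => [th|].
  move: xy; rewrite neq_ltn => /orP[|yx]; first exact: th.
  by apply: (th y x) => //; rewrite finset.setUC.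
have xyp : (val x, val y) \in pairs by rewrite mem_pairs xy ltn_ord.
by exists (val x, val y) => //; apply: val_inj; rewrite val_edge_of //= !inord_val.
Qed.

Lemma adjacentC n (s : graph n) u v : Defs.adjacent s u v = Defs.adjacent s v u.
Proof. by rewrite /Defs.adjacent finset.setUC. Qed.

Lemma adjacent_edge_of s p : p \in pairs ->
  Defs.adjacent s (inord p.1) (inord p.2) = (edge_of p \in s).
Proof.
move=> pP; apply/existsP/idP => [[e /andP[es /eqP eE]]|ps]; last first.
  by exists (edge_of p); rewrite ps val_edge_of // eqxx.
by rewrite (_ : edge_of p = e) //; apply: val_inj; rewrite val_edge_of // eE.
Qed.

Lemma dominates1 (s : graph 5) (v : 'I_5) :
  dominates [set v]%SET s = (encode edge_of (star v) \subset s).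
Proof.
apply/forallP/encode_subP => [vs p|vs u].
  rewrite mem_filter => /andP[pv pP]; rewrite -adjacent_edge_of //.
  have := pP; rewrite mem_pairs => /andP[p12 p2]; have p1 := ltn_trans p12 p2.
  have adj u : u != v -> Defs.adjacent s u v.
    by move=> uv; have := vs u; rewrite inE uv => /existsP[w /andP[/set1P ->]].
  have [p1v|p1v] := eqVneq p.1 v.
    by rewrite p1v inord_val adjacentC adj // -val_eqE /= inordK // -p1v gtn_eqF.
  move: pv; rewrite (negPf p1v) /= => /eqP p2v.
  by rewrite p2v inord_val adj // -val_eqE /= inordK.
rewrite inE; apply/implyP => uv; apply/existsP; exists v; rewrite set11 /=.
have [uv'|vu|/val_inj uE] := ltngtP u v; last by rewrite uE eqxx in uv.
  have uvP : (val u, val v) \in pairs by rewrite mem_pairs /= uv' ltn_ord.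
  have := adjacent_edge_of s uvP; rewrite /= !inord_val => ->.
  by apply: vs; rewrite mem_filter uvP /= eqxx orbT.
have vuP : (val v, val u) \in pairs by rewrite mem_pairs /= vu ltn_ord.
have := adjacent_edge_of s vuP; rewrite /= !inord_val adjacentC => ->.
by apply: vs; rewrite mem_filter vuP /= eqxx.
Qed.

(** A dominating set with at most one element is contained in a singleton, which then dominates as
    well; by [dominates1] this singleton corresponds to a star in [s]. *)
Lemma domination_number_ge2 (s : graph 5) :
  (2 <= domination_number s) = avoids [seq encode edge_of f | f <- stars] s.
Proof.
rewrite /domination_number; case: arg_minnP => [|A As minA]; first exact: dominatesT.
apply/idP/allP => [A2 _ /mapP[_ /mapP[v vI ->] ->]|Fs].
  have v5 : v < 5 by move: vI; rewrite mem_iota.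
  rewrite -[v]/(val (Ordinal v5)) -dominates1; apply/negP => /minA.
  by rewrite cards1 leqNgt A2.
rewrite leqNgt; apply/negP => A1.
have [x Ax] : exists x, A \subset [set x]%SET.
  move: A1; rewrite ltnS leq_eqVlt ltnS leqn0 => /orP[/cards1P[x ->]|].
    by exists x.
  by rewrite cards_eq0 => /eqP ->; exists ord0; exact: finset.sub0set.
have sx : encode edge_of (star x) \in [seq encode edge_of f | f <- stars].
  by apply: map_f; apply: map_f; rewrite mem_iota ltn_ord.
have /negP := Fs _ sx; rewrite -dominates1; apply; apply/forallP => v; apply/implyP => vx.
have vA : v \notin A by apply: contra vx; exact: (fintype.subsetP Ax).
have /existsP[w /andP[wA vw]] := implyP (forallP As v) vA.
by apply/existsP; exists w; rewrite vw (fintype.subsetP Ax).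
Qed.

End CompleteGraph5.

(** * The four cells and the collapse of their complement *)

Section FourCells.
Local Open Scope nat_scope.

Local Notation enc := (encode edge_of).
Local Notation D := (domination_complex 5 2).

Lemma encode_subE f t : all (mem pairs) f -> all (mem pairs) t ->
  (enc f \subset enc t) = all (mem t) f.
Proof.
move=> /allP fP /allP tP; apply/encode_subP/allP => ft p pf.
  by have := ft p pf; rewrite (mem_encode edge_of_inj) //; exact: fP.
by rewrite (mem_encode edge_of_inj) //; [exact: ft|exact: fP].
Qed.

Lemma domination_simplicesE s :
  (s \in simplices D) = (s != finset.set0) && avoids [seq enc f | f <- stars] s.
Proof. by rewrite inE domination_number_ge2. Qed.

Definition costar_edge (i : 'I_4) (j : 'I_6) : edge 5 :=
  edge_of (nth (0, 0) (costar i) j).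

(** The last clause says that the K4 avoiding [i] is a facet: an edge outside it joins [i] to some
    [u], and completes the star at [u]. *)
Lemma costarP (i : 'I_4) :
  [/\ uniq (costar i), all (mem pairs) (costar i), size (costar i) = 6 &
      all (fun p => (p \in costar i) ||
        has (fun f => all (mem (p :: costar i)) f) stars) pairs].
Proof. by move: i; case=> [[|[|[|[]]]]]. Qed.

Lemma stars_pairs : all (all (mem pairs)) stars.
Proof. by []. Qed.

Lemma costar_edge_inj i : injective (costar_edge i).
Proof.
have [uc /allP cP cs _] := costarP i.
have nth_pairs (j : 'I_6) : nth (0, 0) (costar i) j \in pairs.
  by apply/cP/mem_nth; rewrite cs.
move=> j k /edge_of_inj jk; apply/val_inj/eqP.
rewrite -(nth_uniq (0, 0) _ _ uc) ?cs ?ltn_ord //.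
by apply/eqP/jk; exact: nth_pairs.
Qed.

Lemma cell_costar i : cell costar_edge i = enc (costar i).
Proof.
have [_ _ cs _] := costarP i; apply/setP => e; rewrite inE.
apply/imsetP/mapP => [[j _ ->]|[p /(nthP (0, 0))[j jc <-] ->]].
  by exists (nth (0, 0) (costar i) j) => //; rewrite mem_nth ?cs.
by rewrite cs in jc; exists (Ordinal jc).
Qed.

Lemma avoids_costar (i : 'I_4) : avoids [seq enc f | f <- stars] (enc (costar i)).
Proof.
have [_ cP _ _] := costarP i; apply/allP => _ /mapP[f fs ->].
rewrite encode_subE ?(allP stars_pairs f fs) //.
by move: f fs; apply/allP; move: i {cP}; case=> [[|[|[|[]]]]].
Qed.

Lemma costar_simplex i : cell costar_edge i \in simplices D.
Proof.
rewrite domination_simplicesE cell_costar avoids_costar andbT -cell_costar.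
exact: cell_neq0.
Qed.

Lemma costar_facet i s : s \in simplices D -> cell costar_edge i \subset s ->
  s = cell costar_edge i.
Proof.
rewrite domination_simplicesE cell_costar => /andP[_ /allP Fs] cs.
apply/eqP; rewrite finset.eqEsubset cs andbT; apply/fintype.subsetP => e es.
have [p pP eE] := edge_of_surj e; have [_ _ _ /allP/(_ p pP)/orP[pc|]] := costarP i.
  by rewrite inE eE map_f.
move=> /hasP[f fs /allP fpc]; have /negP[] := Fs _ (map_f enc fs).
apply/encode_subP => q /fpc /predU1P[->|qc]; first by rewrite -eE.
by apply: (encode_subP _ _ _ cs).
Qed.

Lemma costar_inj : injective (cell costar_edge).
Proof.
move=> i k ik; have: enc (costar i) \subset enc (costar k) by rewrite -!cell_costar ik.
have [_ iP _ _] := costarP i; have [_ kP _ _] := costarP k; rewrite encode_subE //.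
by move: i k {ik iP kP}; do 2![case=> [[|[|[|[]]]] ?] //]; move=> _; exact: val_inj.
Qed.

(* Found by a computer search. *)
Definition collapse_sequence : seq (seq (nat * nat) * (nat * nat)) :=
  [:: ([:: (0, 3); (0, 4); (3, 4)], (1, 2));
      ([:: (1, 2); (1, 4); (2, 4)], (0, 3));
      ([:: (1, 4); (3, 4)], (0, 2));
      ([:: (3, 4)], (0, 1));
      ([:: (2, 4)], (1, 3));
      ([:: (1, 3)], (2, 3));
      ([:: (1, 4)], (1, 2));
      ([:: (1, 2)], (2, 3));
      ([:: (0, 3)], (2, 3));
      ([:: (0, 4)], (0, 1));
      ([:: (0, 1)], (0, 2));
      ([:: (2, 3)], (0, 2))].

(** As each K4 is a facet, forbidding it as a subset removes only its open simplex. The K4 avoiding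
    vertex 4 is kept; it is removed by the sixth collapse, of the faces containing [(1, 3)]. *)
Definition holes := [seq costar i | i <- iota 0 4] ++ stars.

Lemma holes_pairs : all (all (mem pairs)) holes.
Proof. by []. Qed.

Lemma collapse_sequence_collapses :
  collapses [seq enc f | f <- holes]
    [seq encode_step edge_of a | a <- collapse_sequence] (edge_of (0, 2)).
Proof. exact: collapsesP edge_of_inj edge_of_surj _ _ _ holes_pairs _. Qed.

Lemma off_cellsE (R : realType) (x : edge 5 -> R) :
  off_cells D costar_edge x <->
  barycentric x /\ avoids [seq enc f | f <- holes] (supp x).
Proof.
rewrite map_cat /avoids all_cat -/(avoids [seq enc f | f <- stars] _).
split=> [[Kx xN]|[bx /andP[/allP xN Fx]]].
  split; first exact: realization_barycentric Kx.
  have := realization_supp Kx; rewrite domination_simplicesE => /andP[_ ->].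
  rewrite andbT; apply/allP => _ /mapP[_ /mapP[i i4 ->] ->].
  have {}i4 : i < 4 by rewrite mem_iota in i4.
  by rewrite -[i]/(val (Ordinal i4)) -cell_costar.
split=> [|i].
  case: (bx) => x0 x1; split=> //; rewrite -/(supp x) domination_simplicesE Fx andbT.
  exact: barycentric_supp_neq0.
rewrite cell_costar; apply: xN; apply: map_f; apply: map_f.
by rewrite mem_iota ltn_ord.
Qed.

End FourCells.

Theorem proposition1p3 (R : realType) :
  homotopy_equivalent R
    (geometric_realization R (domination_complex 5 2))
    (wedge_of_spheres R 4 5).
Proof.
pose c := [seq encode_step edge_of a | a <- collapse_sequence].
pose pt : edge 5 -> R := fun e => (e == edge_of (0%N, 2%N))%:R.
have cc := collapse_sequence_collapses.
(* Cells are indexed by ['I_m.+1] and the vertices of a cell by ['I_n.+1], so 3 and 5 stand for four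
   cells with six vertices each. Time is scaled by the number of collapses, so that the whole flow
   ends at time 1. *)
apply: (@attached_cells_homotopy_equivalent R _ _ 3 5 costar_edge costar_edge_inj
  costar_simplex costar_facet costar_inj
  (fun x t => flow c x ((size c)%:R * t)) pt).
- by move=> x t t0; rewrite flow_le0 // mulr_ge0_le0.
- by move=> x t /off_cellsE[bx Fx]; apply/off_cellsE; exact: flow_avoids cc bx Fx.
- move=> x t /off_cellsE[bx Fx] t1; apply: flow_end cc bx Fx _.
  by rewrite ler_peMr.
- apply/off_cellsE; split.
    split=> [e|]; first exact: ler0n.
    by rewrite (bigD1 (edge_of (0, 2)%N)) //= /pt eqxx big1 ?addr0 // => e /negPf ->.
  have ptS : supp pt \subset encode edge_of [:: (0, 2)%N].
    by apply/fintype.subsetP => e; rewrite !inE pnatr_eq0 eqb0 negbK.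
  apply: avoidsS ptS _; apply/allP => _ /mapP[f fh ->].
  rewrite encode_subE ?(allP holes_pairs f fh) //.
  by move: f fh; apply/allP.
- move=> T X f y cX cf; apply: flow_cvg => //.
  by apply: mul_cvg => //; exact: cst_cvg.
Qed.
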